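(* Let $F$ be a number field Galois over $\mathbb Q$, $M$ an even integer divisible by the discriminant of $F$, $\mathcal O=\mathcal O_F[1/M]$, $p$ a prime not dividing $M$, $\mathfrak P$ a prime of $\mathcal O$ above $p$, with Frobenius element $\phi_p=\phi_{\mathfrak P}\in\mathrm{Gal}(F/\mathbb Q)$. Let $\sigma_1=\mathrm{id},\sigma_2\in\mathrm{Gal}(F/\mathbb Q)$ be a vertical gauge and let $d\in\mathcal O^\times$ be vertical gauge invariant, i.e. $\sigma_2(d)=d$. Let $E'=F(\alpha,\beta)$ be the field of rational functions on $G'=GL_1^c=\mathrm{Spec}\,\mathcal O[\alpha,\beta,(\alpha^2+\beta^2)^{-1}]$ and set $$\theta_p=\frac{d^p(\alpha^2+\beta^2)^p}{\phi_p(d)(\alpha^{2p}+\beta^{2p})}\in E'.$$ For $i=1,2$ let $\mathrm{Spec}\,E'\xleftarrow{\pi'_p}Y'_{p/E'}\xrightarrow{\varphi'_{pi}}\mathrm{Spec}\,E'$ be the pull-back to $\mathrm{Spec}\,E'$ of the canonical correspondences on $G'$ attached to $q=d\cdot1_2$ (see context). Then $Y'_{p/E'}$ is isomorphic to the spectrum of a field $L'_p$ which, viewed as an extension of $E'$ via $\pi'_p$, is generated by a root $v_p$ of the quadratic polynomial $$2z^2+2z+1-\theta_p.$$ On the other hand, for $u_p=1+v_p$, the homomorphisms $\varphi'_{p1},\varphi'_{p2}:E'\to L'_p$ corresponding to the morphisms $\varphi'_{p1},\varphi'_{p2}$ act on $F$ via $\phi_p$ and act on $\alpha,\beta$ via $$\varphi'_{p1}\begin{pmatrix}\alpha&\beta\\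 -\beta&\alpha\end{pmatrix}=\begin{pmatrix}\alpha^p&\beta^p\\ -\beta^p&\alpha^p\end{pmatrix}\begin{pmatrix}u_p&v_p\\ -v_p&u_p\end{pmatrix},\qquad \varphi'_{p2}\begin{pmatrix}\alpha&\beta\\ -\beta&\alpha\end{pmatrix}=\begin{pmatrix}\alpha^p&\beta^p\\ -\beta^p&\alpha^p\end{pmatrix}\begin{pmatrix}u_p&-v_p\\ {v_p}&u_p\end{pmatrix}.$$
   Context: Homomorphisms are applied to matrices entrywise. Canonical correspondences on $G'$ attached to $q=d\cdot1_2$. In general they are attached to $d_1=\sigma_1^{-1}d$, $d_2=\sigma_2^{-1}d$ (here $d_1=d_2=d$). Let $\phi:\mathcal O\to\mathcal O$ be the ring map induced by $\phi_p$. Put $\mathcal B'=\mathcal O[\alpha,\beta,(\alpha^2+\beta^2)^{-1}]$, $a_i=(\alpha^{2p}+\beta^{2p})\phi(d_i)$, $b_i=(\alpha^2+\beta^2)^pd_i^p$, $A'_i=a_i\cdot1_2$, $B'_i=b_i\cdot1_2$. Let $y=(y_1,y_2)$ be a pair of $2\times2$ matrices $y_i=(y_{ijk})_{j,k}$ of indeterminates, $D(y)=\det(y_1)\det(y_2)(y_{112}y_{221}-y_{211}y_{122})$, and $$\mathcal C'=\mathcal B'[(b_1b_2)^{-1},y,D(y)^{-1}]\big/\big((y_i^tA'_iy_i-B'_i)_{jk},\ (A'_i(y_i-1_2))_{kj}-(A'_j(y_j-1_2))_{ki}\big)_{i,j,k\in\{1,2\}}.$$ In $\mathcal C'$ the $a_i$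 are invertible; put $\theta_i=b_i/a_i$, $s=\prod_{i=1}^2\mathrm{tr}(y_i)\,(\det(y_i)+\theta_i)$, and $Y'=\mathrm{Spec}\,\mathcal C'_s$ (localization at $s$). Let $\pi':Y'\to G'$ be induced by $\mathcal B'\to\mathcal C'_s$; it is étale, and modulo $\mathfrak P$ it has a section with $y_i\mapsto1_2$. Let $Y'_{p/G'}$ be the irreducible component of $Y'$ containing the image of this section. For $i=1,2$ let $\varphi'_i:Y'\to G'$ be given by the ring homomorphism $\mathcal B'\to\mathcal C'_s$ which is $\phi$ on $\mathcal O$ and sends $\begin{pmatrix}\alpha&\beta\\ -\beta&\alpha\end{pmatrix}\mapsto\begin{pmatrix}\alpha^p&\beta^p\\ -\beta^p&\alpha^p\end{pmatrix}y_i$ (this is well defined since the image of $y_i$ in $GL_2(\mathcal C'_s)$ commutes with $\begin{pmatrix}0&1\\ -1&0\end{pmatrix}$). The canonical correspondences on $G'$ are $G'\xleftarrow{\pi'_p}Y'_{p/G'}\xrightarrow{\varphi'_{pi}}G'$ with $\pi'_p,\varphi'_{pi}$ the restrictions of $\pi',\varphi'_i$. (They algebraize the Frobenius lifts of the arithmetic Levi-Civita connection attached to $q$.) Pull-back to the generic point. The pull-back of a correspondence $X\xleftarrow{\pi}Y\xrightarrow{\varphi}X$ via $u:X'\to X$ is the correspondence on $X'$ given by $(X'\times_{u,X,\pi}Y)\times_Y(Y\times_{\varphi,X,u}X')$ with the two projections to $X'$. For the canonical correspondences $G'\xleftarrow{\pi'_p}Y'_{p/G'}\xrightarrow{\varphi'_{pi}}G'$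 and $u:\mathrm{Spec}\,E'\to G'$ the resulting scheme $Y'_{p/E'}$ is, for both $i=1,2$, the spectrum of the function field of $Y'_{p/G'}$. *)

(* Defs.v *)
From HB Require Import structures.
From mathcomp Require Import all_boot all_order all_algebra all_field.
From mathcomp Require Import boolp.
From mathcomp Require Import mpoly ring.

Set Implicit Arguments.
Unset Strict Implicit.
Unset Printing Implicit Defensive.

Import GRing.Theory.
Local Open Scope ring_scope.
Local Open Scope quotient_scope.

(** All schemes involved are affine, so a scheme is represented by its
    coordinate ring, a morphism of schemes by the ring homomorphism in the
    opposite direction, and a fibre product by a pushout of commutative rings.
    Rings obtained as quotients or localizations are [comPzRingType]s: the zero
    ring is allowed, so no nontriviality proof is built into them. *)

Section Ideals.
Variable R : comPzRingType.
Implicit Types I S : R -> Prop.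

Definition is_ideal I : Prop :=
  [/\ I 0, forall x y, I x -> I y -> I (x + y) & forall a x, I x -> I (a * x)].

Definition is_prime_ideal I : Prop :=
  [/\ is_ideal I, ~ I 1 & forall x y, I (x * y) -> I x \/ I y].

(* The irreducible components of [Spec R] are the closed subschemes
   [Spec (R / I)] with [I] a minimal prime. *)
Definition is_minimal_prime I : Prop :=
  is_prime_ideal I /\
  forall J, is_prime_ideal J -> (forall x, J x -> I x) -> forall x, I x -> J x.

Definition ideal_gen S (x : R) : Prop :=
  forall I, is_ideal I -> (forall y, S y -> I y) -> I x.

Lemma ideal_gen_is_ideal S : is_ideal (ideal_gen S).
Proof.
split=> [I [I0 _ _] _ //|x y Sx Sy I idI SI|a x Sx I idI SI].
  by case: (idI) => _ + _; apply; [apply: Sx | apply: Sy].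
by case: (idI) => _ _; apply; apply: Sx.
Qed.

(* An inverse of [x] if there is one, and 0 otherwise. *)
Definition pzinv (x : R) : R :=
  if pselect (exists y, x * y = 1) is left h then projT1 (cid h) else 0.

End Ideals.

Section Quotient.
Variables (R : comPzRingType) (S : R -> Prop).

Let I := ideal_gen S.
Let I0 : I 0. Proof. by case: (ideal_gen_is_ideal S). Qed.
Let ID x y : I x -> I y -> I (x + y).
Proof. by case: (ideal_gen_is_ideal S) => _ + _; apply. Qed.
Let IM a x : I x -> I (a * x).
Proof. by case: (ideal_gen_is_ideal S) => _ _; apply. Qed.
Let IN x : I x -> I (- x).
Proof. by rewrite -mulN1r; apply: IM. Qed.

Definition quot_rel : rel R := fun x y => `[< ideal_gen S (x - y) >].

Fact quot_rel_refl : reflexive quot_rel.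
Proof. by move=> x; apply/asboolP; rewrite subrr. Qed.

Fact quot_rel_sym : ssrbool.symmetric quot_rel.
Proof. by move=> x y; apply/asboolP/asboolP => /IN; rewrite opprB. Qed.

Fact quot_rel_trans : transitive quot_rel.
Proof.
move=> y x z /asboolP Ixy /asboolP Iyz; apply/asboolP.
by rewrite -(subrK y x) -addrA; apply: ID.
Qed.

Canonical quot_equiv :=
  EquivRel quot_rel quot_rel_refl quot_rel_sym quot_rel_trans.

Definition quot := {eq_quot quot_equiv}.
HB.instance Definition _ := Choice.on quot.
HB.instance Definition _ : EqQuotient _ quot_equiv quot := EqQuotient.on quot.

Definition quot_pi (x : R) : quot := \pi_quot x.

Lemma quot_piP x y : quot_pi x = quot_pi y <-> ideal_gen S (x - y).
Proof. by split=> [/eqquotP /asboolP | h]; [ | apply/eqquotP/asboolP]. Qed.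

Let reprK (u : quot) : quot_pi (repr u) = u. Proof. exact: reprK. Qed.

Let quotW (P : quot -> Prop) : (forall x, P (quot_pi x)) -> forall u, P u.
Proof. by move=> h u; rewrite -(reprK u). Qed.

Definition quot_add (u v : quot) : quot := quot_pi (repr u + repr v).
Definition quot_opp (u : quot) : quot := quot_pi (- repr u).
Definition quot_mul (u v : quot) : quot := quot_pi (repr u * repr v).

Let quot_addE x y : quot_add (quot_pi x) (quot_pi y) = quot_pi (x + y).
Proof.
by apply/quot_piP; rewrite opprD addrACA; apply: ID; apply/quot_piP; rewrite reprK.
Qed.

Let quot_oppE x : quot_opp (quot_pi x) = quot_pi (- x).
Proof. by apply/quot_piP; rewrite -opprD; apply: IN; apply/quot_piP; rewrite reprK. Qed.

Let quot_mulE x y : quot_mul (quot_pi x) (quot_pi y) = quot_pi (x * y).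
Proof.
apply/quot_piP; set x' := repr _; set y' := repr _.
have -> : x' * y' - x * y = x' * (y' - y) + y * (x' - x).
  by rewrite !mulrBr addrA (mulrC y x') subrK (mulrC x).
by apply: ID; apply: IM; apply/quot_piP; rewrite reprK.
Qed.

Fact quot_addA : associative quot_add.
Proof. by do 3!elim/quotW=> ?; rewrite !quot_addE addrA. Qed.
Fact quot_addC : commutative quot_add.
Proof. by do 2!elim/quotW=> ?; rewrite !quot_addE addrC. Qed.
Fact quot_add0 : left_id (quot_pi 0) quot_add.
Proof. by elim/quotW=> ?; rewrite !quot_addE add0r. Qed.
Fact quot_addN : left_inverse (quot_pi 0) quot_opp quot_add.
Proof. by elim/quotW=> ?; rewrite quot_oppE quot_addE addNr. Qed.
Fact quot_mulA : associative quot_mul.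
Proof. by do 3!elim/quotW=> ?; rewrite !quot_mulE mulrA. Qed.
Fact quot_mulC : commutative quot_mul.
Proof. by do 2!elim/quotW=> ?; rewrite !quot_mulE mulrC. Qed.
Fact quot_mul1 : left_id (quot_pi 1) quot_mul.
Proof. by elim/quotW=> ?; rewrite !quot_mulE mul1r. Qed.
Fact quot_mulD : left_distributive quot_mul quot_add.
Proof. by do 3!elim/quotW=> ?; rewrite !(quot_addE, quot_mulE) mulrDl. Qed.

HB.instance Definition _ :=
  GRing.isZmodule.Build quot quot_addA quot_addC quot_add0 quot_addN.
HB.instance Definition _ :=
  GRing.Zmodule_isComPzRing.Build quot quot_mulA quot_mulC quot_mul1 quot_mulD.

Fact quot_pi_is_zmod_morphism : zmod_morphism quot_pi.
Proof. by move=> x y; rewrite -quot_addE -quot_oppE. Qed.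
Fact quot_pi_is_monoid_morphism : monoid_morphism quot_pi.
Proof. by split=> // x y; rewrite -quot_mulE. Qed.
HB.instance Definition _ :=
  GRing.isZmodMorphism.Build R quot quot_pi quot_pi_is_zmod_morphism.
HB.instance Definition _ :=
  GRing.isMonoidMorphism.Build R quot quot_pi quot_pi_is_monoid_morphism.

End Quotient.

(* [loc s] is [R[1/s]]; the class of [(x, n)] stands for [x / s ^+ n]. *)

Section Localization.
Variables (R : comPzRingType) (s : R).

Definition loc_rel : rel (R * nat) := fun u v =>
  `[< exists k, s ^+ k * (u.1 * s ^+ v.2) = s ^+ k * (v.1 * s ^+ u.2) >].

Fact loc_rel_refl : reflexive loc_rel.
Proof. by move=> u; apply/asboolP; exists 0. Qed.

Fact loc_rel_sym : ssrbool.symmetric loc_rel.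
Proof. by move=> u v; apply/asboolP/asboolP => -[k e]; exists k. Qed.

Fact loc_rel_trans : transitive loc_rel.
Proof.
move=> [y m] [x n] [z q] /asboolP[k /= ek] /asboolP[l /= el]; apply/asboolP.
exists (k + l + m)%N; rewrite /= !exprD.
transitivity (s ^+ l * s ^+ q * (s ^+ k * (x * s ^+ m))); first by ring.
rewrite ek; transitivity (s ^+ k * s ^+ n * (s ^+ l * (y * s ^+ q))); first by ring.
by rewrite el; ring.
Qed.

Canonical loc_equiv := EquivRel loc_rel loc_rel_refl loc_rel_sym loc_rel_trans.

Definition loc := {eq_quot loc_equiv}.
HB.instance Definition _ := Choice.on loc.
HB.instance Definition _ : EqQuotient _ loc_equiv loc := EqQuotient.on loc.

Definition loc_frac (u : R * nat) : loc := \pi_loc u.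

Lemma loc_fracP x n y m : loc_frac (x, n) = loc_frac (y, m) <->
  exists k, s ^+ k * (x * s ^+ m) = s ^+ k * (y * s ^+ n).
Proof. by split=> [/eqquotP /asboolP | h]; [ | apply/eqquotP/asboolP]. Qed.

Let locW (P : loc -> Prop) : (forall x n, P (loc_frac (x, n))) -> forall u, P u.
Proof. by move=> h u; rewrite -(reprK u); case: (repr u). Qed.

Let add_frac (u v : R * nat) : R * nat :=
  (u.1 * s ^+ v.2 + v.1 * s ^+ u.2, (u.2 + v.2)%N).
Let mul_frac (u v : R * nat) : R * nat := (u.1 * v.1, (u.2 + v.2)%N).

Definition loc_add (u v : loc) : loc := loc_frac (add_frac (repr u) (repr v)).
Definition loc_opp (u : loc) : loc := loc_frac (- (repr u).1, (repr u).2).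
Definition loc_mul (u v : loc) : loc := loc_frac (mul_frac (repr u) (repr v)).

Let reprP x n : exists k, s ^+ k * ((repr (loc_frac (x, n))).1 * s ^+ n) =
  s ^+ k * (x * s ^+ (repr (loc_frac (x, n))).2).
Proof. by apply/loc_fracP; rewrite -surjective_pairing [LHS]reprK. Qed.

Let loc_addE x n y m : loc_add (loc_frac (x, n)) (loc_frac (y, m)) =
  loc_frac (x * s ^+ m + y * s ^+ n, (n + m)%N).
Proof.
rewrite /loc_add /add_frac; have [k ek] := reprP x n; have [l el] := reprP y m.
move: (repr (loc_frac (x, n))) (repr (loc_frac (y, m))) ek el => [x' n'] [y' m'] /= ek el.
apply/loc_fracP; exists (k + l)%N; rewrite !exprD.
transitivity (s ^+ l * s ^+ m' * s ^+ m * (s ^+ k * (x' * s ^+ n))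
            + s ^+ k * s ^+ n' * s ^+ n * (s ^+ l * (y' * s ^+ m))); first by ring.
by rewrite ek el; ring.
Qed.

Let loc_oppE x n : loc_opp (loc_frac (x, n)) = loc_frac (- x, n).
Proof.
rewrite /loc_opp; have [k ek] := reprP x n.
move: (repr _) ek => [x' n'] /= ek.
by apply/loc_fracP; exists k; rewrite !mulNr !mulrN ek.
Qed.

Let loc_mulE x n y m :
  loc_mul (loc_frac (x, n)) (loc_frac (y, m)) = loc_frac (x * y, (n + m)%N).
Proof.
rewrite /loc_mul /mul_frac; have [k ek] := reprP x n; have [l el] := reprP y m.
move: (repr (loc_frac (x, n))) (repr (loc_frac (y, m))) ek el => [x' n'] [y' m'] /= ek el.
apply/loc_fracP; exists (k + l)%N; rewrite !exprD.
transitivity ((s ^+ k * (x' * s ^+ n)) * (s ^+ l * (y' * s ^+ m))); first by ring.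
by rewrite ek el; ring.
Qed.

Let loc_eq x n y m : x * s ^+ m = y * s ^+ n -> loc_frac (x, n) = loc_frac (y, m).
Proof. by move=> e; apply/loc_fracP; exists 0; rewrite !mul1r. Qed.

Fact loc_addA : associative loc_add.
Proof.
by do 3!elim/locW=> ? ?; rewrite !loc_addE; apply: loc_eq; rewrite !exprD; ring.
Qed.
Fact loc_addC : commutative loc_add.
Proof.
by do 2!elim/locW=> ? ?; rewrite !loc_addE; apply: loc_eq; rewrite !exprD; ring.
Qed.
Fact loc_add0 : left_id (loc_frac (0, 0)) loc_add.
Proof.
by elim/locW=> ? ?; rewrite loc_addE; apply: loc_eq; rewrite add0n; ring.
Qed.
Fact loc_addN : left_inverse (loc_frac (0, 0)) loc_opp loc_add.
Proof.
by elim/locW=> ? ?; rewrite loc_oppE loc_addE; apply: loc_eq; rewrite !exprD; ring.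
Qed.
Fact loc_mulA : associative loc_mul.
Proof.
by do 3!elim/locW=> ? ?; rewrite !loc_mulE; apply: loc_eq; rewrite !exprD; ring.
Qed.
Fact loc_mulC : commutative loc_mul.
Proof.
by do 2!elim/locW=> ? ?; rewrite !loc_mulE; apply: loc_eq; rewrite !exprD; ring.
Qed.
Fact loc_mul1 : left_id (loc_frac (1, 0)) loc_mul.
Proof. by elim/locW=> ? ?; rewrite loc_mulE mul1r. Qed.
Fact loc_mulD : left_distributive loc_mul loc_add.
Proof.
do 3!elim/locW=> ? ?; rewrite !(loc_addE, loc_mulE); apply: loc_eq.
by rewrite !exprD; ring.
Qed.

HB.instance Definition _ :=
  GRing.isZmodule.Build loc loc_addA loc_addC loc_add0 loc_addN.
HB.instance Definition _ :=
  GRing.Zmodule_isComPzRing.Build loc loc_mulA loc_mulC loc_mul1 loc_mulD.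

Definition loc_map (x : R) : loc := loc_frac (x, 0).

Fact loc_map_is_zmod_morphism : zmod_morphism loc_map.
Proof.
move=> x y; rewrite -[RHS]/(loc_add _ (loc_opp _)) loc_oppE loc_addE.
by apply: loc_eq; rewrite !mulr1.
Qed.
Fact loc_map_is_monoid_morphism : monoid_morphism loc_map.
Proof. by split=> // x y; rewrite -[RHS]/(loc_mul _ _) loc_mulE. Qed.
HB.instance Definition _ :=
  GRing.isZmodMorphism.Build R loc loc_map loc_map_is_zmod_morphism.
HB.instance Definition _ :=
  GRing.isMonoidMorphism.Build R loc loc_map loc_map_is_monoid_morphism.

End Localization.

Section GeneratedSubring.
Variables (K : comNzRingType) (S : K -> Prop).

Definition subring_gen : {pred K} := fun x =>
  `[< forall A : {pred K}, subring_closed A -> (forall y, S y -> y \in A) -> x \in A >].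

Lemma subring_genP x : reflect
  (forall A : {pred K}, subring_closed A -> (forall y, S y -> y \in A) -> x \in A)
  (x \in subring_gen).
Proof. exact: asboolP. Qed.

Lemma mem_subring_gen x : S x -> x \in subring_gen.
Proof. by move=> Sx; apply/subring_genP => A _; apply. Qed.

Fact subring_gen_closed : subring_closed subring_gen.
Proof.
split=> [|x y /subring_genP hx /subring_genP hy|x y /subring_genP hx /subring_genP hy];
  apply/subring_genP => A cA SA; case: (cA) => A1 AB AM //.
- by apply: AB; [apply: hx | apply: hy].
- by apply: AM; [apply: hx | apply: hy].
Qed.
HB.instance Definition _ := GRing.isSubringClosed.Build K subring_gen subring_gen_closed.

Record subring_type : Type :=
  Subring { subring_val : K; subring_valP : subring_val \in subring_gen }.
HB.instance Definition _ := [isSub for subring_val].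
HB.instance Definition _ := [Choice of subring_type by <:].
HB.instance Definition _ := [SubChoice_isSubComNzRing of subring_type by <:].

End GeneratedSubring.

Section NumberField.
Variable F : splittingFieldType rat.

Definition is_integral (x : F) : Prop := integralOver (intr : int -> F) x.

Definition is_integral_basis (w : (\dim {:F}).-tuple F) : Prop :=
  [/\ basis_of {:F} w, forall i, is_integral (tnth w i) &
      forall x, is_integral x ->
        exists c : 'I_(\dim {:F}) -> int, x = \sum_i tnth w i *~ c i].

Definition is_discriminant (D : int) : Prop :=
  exists2 w, is_integral_basis w &
    D%:~R = \det (\matrix_(i, j) galTrace 1%AS {:F} (tnth w i * tnth w j)).

Variable M : int.

(* [O_F[1/M]] *)
Definition OF : Type := subring_type (fun x : F => is_integral x \/ x = M%:~R^-1).
HB.instance Definition _ := GRing.ComNzRing.on OF.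

Definition OF_val : {rmorphism OF -> F} := [the {rmorphism OF -> F} of val].

Fact gal_OF_subproof (g : gal_of {:F}) (x : OF) :
  g (OF_val x) \in subring_gen (fun x : F => is_integral x \/ x = M%:~R^-1).
Proof.
apply/subring_genP => A [A1 AB AM] SA.
have /subring_genP := subring_valP x.
move=> /(_ [pred z | g z \in A]) /=; apply.
  split=> [|u v|u v]; rewrite !inE ?rmorph1 //.
  - by rewrite rmorphB; apply: AB.
  - by rewrite rmorphM; apply: AM.
move=> z [[q qm qz]|->]; rewrite inE; apply: SA; [left|right].
  exists q => //; have := rmorph_root g qz; rewrite -map_poly_comp.
  congr (root _ _); apply: eq_map_poly => c /=; exact: rmorph_int.
by rewrite fmorphV rmorph_int.
Qed.

Definition gal_OF (g : gal_of {:F}) (x : OF) : OF := Subring (gal_OF_subproof g x).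

Fact gal_OF_is_zmod_morphism g : zmod_morphism (gal_OF g).
Proof. by move=> x y; apply: val_inj; rewrite /= !rmorphB. Qed.
Fact gal_OF_is_monoid_morphism g : monoid_morphism (gal_OF g).
Proof. by split=> [|x y]; apply: val_inj; rewrite /= ?rmorph1 // !rmorphM. Qed.
HB.instance Definition _ g :=
  GRing.isZmodMorphism.Build OF OF (gal_OF g) (gal_OF_is_zmod_morphism g).
HB.instance Definition _ g :=
  GRing.isMonoidMorphism.Build OF OF (gal_OF g) (gal_OF_is_monoid_morphism g).

Definition is_frobenius (P : OF -> Prop) (p : nat) (phi : gal_of {:F}) : Prop :=
  forall x : OF, P (gal_OF phi x - x ^+ p).

Definition EF : fieldType := {fraction {mpoly F[2]}}.

Definition EF_const : {rmorphism F -> EF} :=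
  [the {rmorphism F -> EF} of (@tofrac _ \o @mpolyC 2 F)].
Definition alpha : EF := tofrac ('X_ord0 : {mpoly F[2]}).
Definition beta : EF := tofrac ('X_ord_max : {mpoly F[2]}).

(* [O[alpha, beta, (alpha^2 + beta^2)^-1]] *)
Definition BF_gen (x : EF) : Prop :=
  [\/ exists c : OF, x = EF_const (OF_val c), x = alpha, x = beta
    | x = (alpha ^+ 2 + beta ^+ 2)^-1].
Definition BF : Type := subring_type BF_gen.
HB.instance Definition _ := GRing.ComNzRing.on BF.

Definition BF_val : {rmorphism BF -> EF} := [the {rmorphism BF -> EF} of val].

Fact BF_const_subproof (c : OF) : EF_const (OF_val c) \in subring_gen BF_gen.
Proof. by apply: mem_subring_gen; apply: Or41; exists c. Qed.
Fact alphaB_subproof : alpha \in subring_gen BF_gen.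
Proof. by apply: mem_subring_gen; apply: Or42. Qed.
Fact betaB_subproof : beta \in subring_gen BF_gen.
Proof. by apply: mem_subring_gen; apply: Or43. Qed.

Definition BF_const (c : OF) : BF := Subring (BF_const_subproof c).
Definition alphaB : BF := Subring alphaB_subproof.
Definition betaB : BF := Subring betaB_subproof.

Fact BF_const_is_zmod_morphism : zmod_morphism BF_const.
Proof. by move=> x y; apply: val_inj; rewrite /= !rmorphB. Qed.
Fact BF_const_is_monoid_morphism : monoid_morphism BF_const.
Proof. by split=> [|x y]; apply: val_inj; rewrite /= ?rmorph1 // !rmorphM. Qed.
HB.instance Definition _ :=
  GRing.isZmodMorphism.Build OF BF BF_const BF_const_is_zmod_morphism.
HB.instance Definition _ :=
  GRing.isMonoidMorphism.Build OF BF BF_const BF_const_is_monoid_morphism.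

End NumberField.

Arguments EF_const {F}.
Arguments alpha {F}.
Arguments beta {F}.
Arguments OF_val {F M}.
Arguments BF_val {F M}.
Arguments BF_const {F M}.
Arguments alphaB {F M}.
Arguments betaB {F M}.

(* [[a, b], [-b, a]], the elements of [GL_1^c] *)
Definition cmx (R : pzRingType) (a b : R) : 'M[R]_2 :=
  \matrix_(i, j) if i == j then a else if (i < j)%N then b else - b.

(* The mathematical indices 1, 2 are the elements 0, 1 of ['I_2]; the
   indeterminate [y_ijk] is the entry [(j, k)] of the matrix [yX i]. *)

Section CanonicalCorrespondences.
Variables (F : splittingFieldType rat) (M : int) (p : nat).
Variables (phi : gal_of {:F}) (d : 'I_2 -> OF F M).

Notation O := (OF F M).
Notation B := (BF F M).

Definition a_ (i : 'I_2) : B :=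
  (alphaB ^+ (2 * p) + betaB ^+ (2 * p)) * BF_const (gal_OF phi (d i)).
Definition b_ (i : 'I_2) : B :=
  (alphaB ^+ 2 + betaB ^+ 2) ^+ p * BF_const (d i) ^+ p.

Definition Yvar : finType := ('I_2 * 'I_2 * 'I_2)%type.
Definition Bpoly : comNzRingType := {mpoly B[#|Yvar|]}.
Definition yX (i : 'I_2) : 'M[Bpoly]_2 :=
  \matrix_(j, k) 'X_(enum_rank ((i, j, k) : Yvar)).

Definition DX : Bpoly :=
  \det (yX 0) * \det (yX 1) * (yX 0 0 1 * yX 1 1 0 - yX 1 0 0 * yX 0 1 1).

(* [B'[(b_1 b_2)^-1, y, D(y)^-1]] *)
Definition Cloc : comPzRingType := loc ((b_ 0 * b_ 1)%:MP * DX).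
Definition B_Cloc : {rmorphism B -> Cloc} :=
  [the {rmorphism B -> Cloc} of
     (@loc_map Bpoly ((b_ 0 * b_ 1)%:MP * DX) \o @mpolyC #|Yvar| B)].
Definition yloc (i : 'I_2) : 'M[Cloc]_2 := map_mx (@loc_map Bpoly _) (yX i).

Definition Amx (i : 'I_2) : 'M[Cloc]_2 := (B_Cloc (a_ i))%:M.
Definition Bmx (i : 'I_2) : 'M[Cloc]_2 := (B_Cloc (b_ i))%:M.

Definition Crel (x : Cloc) : Prop :=
  exists i j k : 'I_2,
    x = ((yloc i)^T *m Amx i *m yloc i - Bmx i) j k \/
    x = (Amx i *m (yloc i - 1%:M)) k j - (Amx j *m (yloc j - 1%:M)) k i.

Definition C' : comPzRingType := quot Crel.
Definition B_C' : {rmorphism B -> C'} :=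
  [the {rmorphism B -> C'} of (@quot_pi _ Crel \o B_Cloc)].
Definition yC' (i : 'I_2) : 'M[C']_2 := map_mx (@quot_pi _ Crel) (yloc i).

Definition theta_ (i : 'I_2) : C' := B_C' (b_ i) * pzinv (B_C' (a_ i)).
Definition sC' : C' := \prod_i (\tr (yC' i) * (\det (yC' i) + theta_ i)).

(* [C'_s], the coordinate ring of [Y'] *)
Definition Cs : comPzRingType := loc sC'.
Definition pi' : {rmorphism B -> Cs} :=
  [the {rmorphism B -> Cs} of (@loc_map _ sC' \o B_C')].
Definition ys (i : 'I_2) : 'M[Cs]_2 := map_mx (@loc_map _ sC') (yC' i).

(* [B' / P B'] *)
Definition BmodP (P : O -> Prop) : comPzRingType :=
  quot (fun x : B => exists2 c : O, P c & x = BF_const c).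

Definition is_section (P : O -> Prop) (S : {rmorphism Cs -> BmodP P}) : Prop :=
  (forall b : B, S (pi' b) = quot_pi _ b) /\ forall i, map_mx S (ys i) = 1%:M.

(* [Spec (C'_s / Q)] is an irreducible component of [Y'] containing the image
   of the section [S]. *)
Definition is_component (P : O -> Prop) (S : {rmorphism Cs -> BmodP P})
    (Q : Cs -> Prop) : Prop :=
  is_minimal_prime Q /\
  forall q : BmodP P -> Prop, is_prime_ideal q -> forall x, Q x -> q (S x).

Definition is_phi' (i : 'I_2) (f : {rmorphism B -> Cs}) : Prop :=
  (forall c : O, f (BF_const c) = pi' (BF_const (gal_OF phi c))) /\
  map_mx f (cmx alphaB betaB) =
    map_mx pi' (cmx (alphaB ^+ p) (betaB ^+ p)) *m ys i.

(* [S], [Q] and [phi'] are determined by these conditions: [C'_s] is generated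
   over [B'] by the [y_ijk] and inverses, [B'] by [O], [alpha], [beta] and an
   inverse, and the components of the normal scheme [Y'] are disjoint. *)
Definition is_canonical_data (P : O -> Prop) (S : {rmorphism Cs -> BmodP P})
    (Q : Cs -> Prop) (phi' : 'I_2 -> {rmorphism B -> Cs}) : Prop :=
  [/\ is_section S, is_component S Q & forall i, is_phi' i (phi' i)].

(* [B' -> C'_s / Q]: the ring side of the restriction to the component of a
   morphism [Y' -> G'] *)
Definition restrict (Q : Cs -> Prop) (f : {rmorphism B -> Cs}) :
    {rmorphism B -> quot Q} :=
  [the {rmorphism B -> quot Q} of (@quot_pi _ Q \o f)].

End CanonicalCorrespondences.

(* [Spec D] is the fibre product of [Spec B1] and [Spec B2] over [Spec A]. *)
Definition is_pushout (A B1 B2 D : comPzRingType)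
    (f1 : {rmorphism A -> B1}) (f2 : {rmorphism A -> B2})
    (g1 : {rmorphism B1 -> D}) (g2 : {rmorphism B2 -> D}) : Prop :=
  g1 \o f1 =1 g2 \o f2 /\
  forall (T : comPzRingType) (h1 : {rmorphism B1 -> T}) (h2 : {rmorphism B2 -> T}),
    h1 \o f1 =1 h2 \o f2 ->
    exists h : {rmorphism D -> T},
      [/\ h \o g1 =1 h1, h \o g2 =1 h2 &
          forall h' : {rmorphism D -> T},
            h' \o g1 =1 h1 -> h' \o g2 =1 h2 -> h' =1 h].

(* The correspondence [Spec X' <-l- Spec Z -r-> Spec X'], with the projection
   [c] from [Spec Z] to [Spec Y], is the pull-back of
   [Spec X <-pi- Spec Y -phi-> Spec X] via [u : Spec X' -> Spec X]:
   [Z = (X' x_(u,X,pi) Y) x_Y (Y x_(phi,X,u) X')]. *)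
Definition is_pullback (X X' Y Z : comPzRingType) (u : {rmorphism X -> X'})
    (pi phi : {rmorphism X -> Y})
    (l r : {rmorphism X' -> Z}) (c : {rmorphism Y -> Z}) : Prop :=
  exists (W1 W2 : comPzRingType)
    (i1 : {rmorphism X' -> W1}) (j1 : {rmorphism Y -> W1})
    (i2 : {rmorphism X' -> W2}) (j2 : {rmorphism Y -> W2})
    (k1 : {rmorphism W1 -> Z}) (k2 : {rmorphism W2 -> Z}),
  [/\ is_pushout u pi i1 j1, is_pushout phi u j2 i2, is_pushout j1 j2 k1 k2 &
      [/\ l =1 k1 \o i1, r =1 k2 \o i2 & c =1 k1 \o j1]].

Definition generates (K L : fieldType) (f : {rmorphism K -> L}) (v : L) : Prop :=
  forall A : {pred L}, divring_closed A ->
    (forall x, f x \in A) -> v \in A -> forall x, x \in A.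

Definition theta_p (F : splittingFieldType rat) (p : nat) (phi : gal_of {:F})
    (d : F) : EF F :=
  (EF_const d ^+ p * (alpha ^+ 2 + beta ^+ 2) ^+ p)
    / (EF_const (phi d) * (alpha ^+ (2 * p) + beta ^+ (2 * p))).

(* The [d_i = sigma_i^-1 d] of the metric [q = d . 1_2] *)
Definition gauge_twist (F : splittingFieldType rat) (M : int)
    (sigma : 'I_2 -> gal_of {:F}) (d : OF F M) (i : 'I_2) : OF F M :=
  gal_OF (sigma i)^-1%g d.

(* Main.v *)
(* In [C'_s] the relations force [y_1 = [[1 + v, v], [-v, 1 + v]]] and
   [y_2 = [[1 + v, -v], [v, 1 + v]]] with [2 v^2 + 2 v + 1 = theta]: orthogonality
   and the invertibility of [det y_i + theta] give [det y_i = theta], hence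
   [y_i^t = adj y_i], and the symmetry relation links [y_1] to [y_2].

   The quadratic polynomial has no root in [E'], because [2 theta - 1] is not a
   square: after the substitution [alpha = x t, beta = t] this is an
   odd-multiplicity argument at the simple roots of
   [(x^(2p) + 1) / (x^2 + 1)]. So [L = E'(v)] is a quadratic extension of [E'],
   and every element of [C'_s] is, up to units, of the form [b_0 + b_1 v] with
   [b_0, b_1] in [B'], so that [C'_s] embeds in [L]. In particular [C'_s] is a
   domain, its only minimal prime is [0], and [L] is its fraction field.

   The pull-back along [phi'_i] is trivial as soon as [phi'_i] is injective.
   Composed with the section modulo [P], [phi'_i] is the Frobenius of [B' / P B'],
   which is injective since [P B'] is prime (Gauss). As the localization of [O] at
   [P] is a valuation ring, each nonzero polynomial over [F] has a multiple by an
   element of [F] that lies in [O[alpha, beta]] and is nonzero modulo [P], so a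
   nonzero kernel of [phi'_i] would contradict this. *)
Require Import Defs.
From HB Require Import structures.
From mathcomp Require Import all_boot all_order all_algebra all_field.
From mathcomp Require Import boolp mpoly ring.
Import GRing.Theory.
Local Open Scope ring_scope.
Local Open Scope quotient_scope.

Set Implicit Arguments.
Unset Strict Implicit.
Unset Printing Implicit Defensive.

(** * Fractions, localizations and quotients *)

(** The rings here carry no unit structure and may be zero, so invertibility is a bare existence
    statement. *)
Definition invertible (T : comPzRingType) (x : T) : Prop := exists c, x * c = 1.

Section Invertible.
Variables (S T : comPzRingType) (f : {rmorphism S -> T}).

Lemma invertibleM (x y : T) : invertible x -> invertible y -> invertible (x * y).
Proof. by move=> [a xa] [b yb]; exists (a * b); rewrite mulrACA xa yb mulr1. Qed.

Lemma invertibleX (x : T) n : invertible x -> invertible (x ^+ n).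
Proof.
move=> ux; elim: n => [|n IHn]; first by exists 1; rewrite mulr1.
by rewrite exprS; apply: invertibleM.
Qed.

Lemma invertible_mull (x y : T) : invertible (x * y) -> invertible x.
Proof. by move=> [a xya]; exists (y * a); rewrite mulrA. Qed.

Lemma invertible_mulr (x y : T) : invertible (x * y) -> invertible y.
Proof. by rewrite mulrC; apply: invertible_mull. Qed.

Lemma invertible_rmorph (x : S) : invertible x -> invertible (f x).
Proof. by move=> [a xa]; exists (f a); rewrite -rmorphM xa rmorph1. Qed.

Lemma invertible_mulI (x y z : T) : invertible x -> x * y = x * z -> y = z.
Proof.
by move=> [a xa] exy; rewrite -[y]mul1r -[z]mul1r -xa mulrAC exy mulrAC.
Qed.

Lemma pzinv_mul (x : T) : invertible x -> x * pzinv x = 1.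
Proof. by move=> ux; rewrite /pzinv; case: pselect => // h; case: cid. Qed.

End Invertible.

Lemma invertible_neq0 (K : fieldType) (x : K) : x != 0 -> invertible x.
Proof. by move=> x0; exists x^-1; rewrite divff. Qed.

Section Fractions.
Variables A D T : comPzRingType.
Variables (g : {rmorphism A -> D}) (h : {rmorphism A -> T}).
Hypothesis fracP :
  forall x, exists a b, x * g b = g a /\ invertible (h b).

Lemma frac_ext_uniq (k1 k2 : {rmorphism D -> T}) :
  k1 \o g =1 h -> k2 \o g =1 h -> k1 =1 k2.
Proof.
move=> e1 e2 x; have [a [b [xb hb]]] := fracP x.
apply: (invertible_mulI hb); rewrite -[in LHS]e1 -[in RHS]e2 /= -!rmorphM.
by rewrite !(mulrC (g b)) xb; transitivity (h a); [exact: e1 | rewrite -e2].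
Qed.

(** Universal property of fractions, with denominators required to be invertible only in the target;
    this covers localizations, fraction fields and, with denominator 1, quotients. Well-definedness
    is cross-multiplication in [D], transported by the inclusion of kernels. *)
Lemma frac_ext : (forall a, g a = 0 -> h a = 0) ->
  exists k : {rmorphism D -> T}, k \o g =1 h.
Proof.
move=> ker_gh.
have /choice[num numP] := fracP; have /choice[den denP] := numP.
have /choice[inv invP] : forall x, exists c, h (den x) * c = 1.
  by move=> x; case: (denP x).
pose k x := h (num x) * inv x.
(* Any representation of [x] as a fraction computes [k x], not only the chosen one. *)
have kP x a b : x * g b = g a -> k x * h b = h a.
  move=> xb; have [xd _] := denP x.
  have /ker_gh : g (num x * b - a * den x) = 0.
    by rewrite rmorphB !rmorphM -xd -xb mulrAC subrr.
  move/eqP; rewrite rmorphB !rmorphM subr_eq0 => /eqP e.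
  by rewrite /k mulrAC e -mulrA invP mulr1.
have kE x y a : x * g (den x * den y) = g a ->
    k x = h a * inv x * inv y.
  move=> /kP <-; rewrite rmorphM -[LHS]mulr1 -[in LHS](invP y) -[LHS]mulr1.
  by rewrite -[in LHS](invP x); ring.
(* Additivity and multiplicativity are checked after multiplying by the common denominator. *)
have uI x y u v : u * h (den x * den y) = v * h (den x * den y) -> u = v.
  move=> e; apply: (@invertible_mulI _ (h (den x * den y))); last by rewrite !(mulrC (h _)).
  by rewrite rmorphM; apply: invertibleM; [exists (inv x) | exists (inv y)].
have kB : zmod_morphism k.
  move=> x y; apply: (uI x y).
  rewrite (@kP _ (num x * den y - num y * den x)); last first.
    by rewrite rmorphB !rmorphM -(denP x).1 -(denP y).1; ring.
  rewrite mulrBl !rmorphM rmorphB !rmorphM.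
  by rewrite -(kP _ _ _ (denP x).1) -(kP _ _ _ (denP y).1); ring.
have kM : monoid_morphism k.
  split=> [|x y].
    by have := @kP 1 1 1; rewrite !rmorph1 !mulr1; apply.
  apply: (uI x y); rewrite (@kP _ (num x * num y)); last first.
    by rewrite !rmorphM -(denP x).1 -(denP y).1; ring.
  by rewrite !rmorphM -(kP _ _ _ (denP x).1) -(kP _ _ _ (denP y).1); ring.
pose K : {rmorphism D -> T} := HB.pack k
  (GRing.isZmodMorphism.Build D T k kB) (GRing.isMonoidMorphism.Build D T k kM).
exists K => a; change (k (g a) = h a).
by have := @kP (g a) a 1; rewrite !rmorph1 !mulr1; apply.
Qed.

End Fractions.

Section LocQuot.
Variable R : comPzRingType.

(** Products in [loc s] are defined through chosen representatives; here arbitrary ones are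
    allowed. *)
Lemma loc_fracM (s : R) x n y m :
  loc_frac s (x, n) * loc_frac s (y, m) = loc_frac s (x * y, (n + m)%N).
Proof.
have reprP z q : exists k, s ^+ k * ((repr (loc_frac s (z, q))).1 * s ^+ q) =
    s ^+ k * (z * s ^+ (repr (loc_frac s (z, q))).2).
  by apply/loc_fracP; rewrite -surjective_pairing [LHS]reprK.
have [k ek] := reprP x n; have [l el] := reprP y m.
rewrite -[LHS]/(loc_mul _ _) /loc_mul.
move: (repr (loc_frac s (x, n))) (repr (loc_frac s (y, m))) ek el.
move=> [x' n'] [y' m'] /= ek el; apply/loc_fracP.
exists (k + l)%N; rewrite !exprD.
transitivity ((s ^+ k * (x' * s ^+ n)) * (s ^+ l * (y' * s ^+ m))); first by ring.
by rewrite ek el; ring.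
Qed.

Lemma loc_map_invertible (s : R) : invertible (loc_map s s).
Proof.
exists (loc_frac s (1, 1)); rewrite [LHS]loc_fracM.
by apply/loc_fracP; exists 0; rewrite /= !mulr1 !mul1r add0n expr1.
Qed.

Lemma loc_map_eq0 (s x : R) : loc_map s x = 0 -> exists k, s ^+ k * x = 0.
Proof. by move/loc_fracP => [k e]; exists k; move: e; rewrite !mulr1 mulr0. Qed.

Lemma loc_fracE (s : R) (u : loc s) : exists x n, u * loc_map s (s ^+ n) = loc_map s x.
Proof.
have [x [n ->]] : exists x n, u = loc_frac s (x, n).
  by exists (repr u).1, (repr u).2; rewrite -surjective_pairing [RHS]reprK.
exists x, n; rewrite [LHS]loc_fracM.
by apply/loc_fracP; exists 0; rewrite !mulr1 addn0.
Qed.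

Lemma loc_lift (s : R) (T : comPzRingType) (h : {rmorphism R -> T}) :
  invertible (h s) -> exists k : {rmorphism loc s -> T}, k \o loc_map s =1 h.
Proof.
move=> hs; apply: frac_ext => [u|a /loc_map_eq0[k ska]].
  have [x [n e]] := loc_fracE u; exists x, (s ^+ n); split=> //.
  by rewrite rmorphXn; apply: invertibleX.
apply: (invertible_mulI (invertibleX k hs)).
by rewrite -rmorphXn -rmorphM ska mulr0 rmorph0.
Qed.

Variable S : R -> Prop.

Lemma quot_pi_surj (u : quot S) : exists x, u = quot_pi S x.
Proof. by exists (repr u); rewrite [RHS]reprK. Qed.

Lemma quot_pi_eq0 x : quot_pi S x = 0 <-> ideal_gen S x.
Proof. by rewrite -(rmorph0 (quot_pi S)) quot_piP subr0. Qed.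

Lemma quot_pi_gen x : S x -> quot_pi S x = 0.
Proof. by move=> Sx; apply/quot_pi_eq0 => I _; apply. Qed.

Lemma ker_is_ideal (T : comPzRingType) (h : {rmorphism R -> T}) :
  is_ideal (fun x => h x = 0).
Proof.
split=> [|x y hx hy|a x hx]; first exact: rmorph0.
  by rewrite rmorphD hx hy addr0.
by rewrite rmorphM hx mulr0.
Qed.

Lemma quot_lift (T : comPzRingType) (h : {rmorphism R -> T}) :
  (forall x, S x -> h x = 0) -> exists k : {rmorphism quot S -> T}, k \o quot_pi S =1 h.
Proof.
move=> hS; apply: frac_ext => [u|a /quot_pi_eq0 aS]; last first.
  exact: (aS (fun x => h x = 0) (ker_is_ideal h) hS).
have [x ->] := quot_pi_surj u; exists x, 1.
by rewrite !rmorph1 mulr1; split=> //; exists 1; rewrite mulr1.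
Qed.

End LocQuot.

(* [K] is a field of fractions of [A] and [D] is the localization of [R] at
   the image of [A \ 0]. *)
Lemma frac_pushout (A R : comPzRingType) (K : fieldType) (D : comPzRingType)
    (f1 : {rmorphism A -> K}) (f2 : {rmorphism A -> R})
    (g1 : {rmorphism K -> D}) (g2 : {rmorphism R -> D}) :
  g1 \o f1 =1 g2 \o f2 ->
  (forall x, exists a b, f1 b != 0 /\ x * f1 b = f1 a) ->
  (forall r, g2 r = 0 -> r = 0) ->
  (forall x, exists r b, f1 b != 0 /\ x * g1 (f1 b) = g2 r) ->
  is_pushout f1 f2 g1 g2.
Proof.
move=> g12 fracK inj_g2 fracD; split=> // T h1 h2 h12.
have uh b : f1 b != 0 -> invertible (h2 (f2 b)).
  move=> fb; rewrite -[h2 _]h12 /=; apply: invertible_rmorph; exact: (invertible_neq0 fb).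
have fracP x : exists a b, x * g2 b = g2 a /\ invertible (h2 b).
  have [r [b [fb e]]] := fracD x.
  by exists r, (f2 b); split; [rewrite -[g2 (f2 b)]g12 | exact: uh].
have [|k kg2] := frac_ext fracP; first by move=> r /inj_g2 ->; rewrite rmorph0.
exists k; split=> // [x|k' _ k'g2]; last exact: (frac_ext_uniq fracP).
(* Compatibility with [h1] is checked on [x = a / b], after cancelling the invertible image of
   [b]. *)
have [a [b [fb e]]] := fracK x; apply: (invertible_mulI (uh b fb)).
rewrite -[h2 (f2 b)]h12 /= -[in RHS]rmorphM mulrC [f1 b * x]mulrC e.
rewrite [h1 (f1 a)]h12 [h1 (f1 b)]h12 /= -!kg2 /=.
by rewrite -[g2 (f2 a)]g12 -[g2 (f2 b)]g12 /= -e !rmorphM.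
Qed.

(** * Irreducibility of the quadratic polynomial *)

Lemma fractionE (R : idomainType) (x : {fraction R}) :
  exists a b : R, b != 0 /\ x * tofrac b = tofrac a.
Proof.
elim/quotW: x => x; exists x.1, x.2; split; first exact: denom_ratioP.
unlock FracField.tofrac; rewrite -[LHS]FracField.pi_mul; apply/eqmodP.
rewrite /= FracField.equivfE /FracField.mulf.
by rewrite !numden_Ratio ?mulf_neq0 ?denom_ratioP ?oner_eq0 // !mulr1 mulrC.
Qed.

Lemma mpoly_hom_ext n (R : comNzRingType) (S : comPzRingType)
    (f g : {rmorphism {mpoly R[n]} -> S}) :
  (forall c, f c%:MP = g c%:MP) -> (forall i, f 'X_i = g 'X_i) -> f =1 g.
Proof.
move=> fgC fgX q; elim/mpolyind: q => [|c m q _ _ IHq]; first by rewrite !rmorph0.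
rewrite !rmorphD IHq -mul_mpolyC !rmorphM fgC mpolyXE_id !rmorph_prod /=.
by congr (_ * _ + _); apply: eq_bigr => i _; rewrite !rmorphXn fgX.
Qed.

Section SquareFreePoly.
Variables (F : fieldType).
Hypothesis char0 : forall n : nat, n%:R = 0 :> F -> n = 0%N.

(** The derivative is [n X^(n-1)] with [n] nonzero in [F], and 0 is not a root of [X^n + 1]. *)
Lemma separable_XnD1 n : (0 < n)%N -> separable_poly ('X^n + 1 : {poly F}).
Proof.
move=> n0; rewrite unlock derivD derivXn -[1 in X in coprimep _ (_ + X)]polyC1 derivC addr0.
have nF : n%:R != 0 :> F by apply/eqP => /char0 e; rewrite e in n0.
rewrite -scaler_nat coprimepZr // coprimep_expr // coprimepX.
by rewrite /root hornerD hornerXn hornerC expr0n eqn0Ngt n0 add0r oner_eq0.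
Qed.

(* For [m / n] in lowest terms, [h] divides [n ^+ 2] and [n ^+ 2] divides the
   square-free [h]. *)
Lemma sqr_ratio_coprime (h g m n : {poly F}) :
  separable_poly h -> coprimep h g -> n != 0 -> m ^+ 2 * h = n ^+ 2 * g ->
  (size h <= 1)%N.
Proof.
move=> sep_h co_hg n0 e.
have h0 : h != 0 by apply: separable_poly_neq0.
have dn0 : gcdp m n != 0 by rewrite gcdp_eq0 negb_and n0 orbT.
set m' := m %/ gcdp m n; set n' := n %/ gcdp m n.
have em : m = m' * gcdp m n by rewrite divpK ?dvdp_gcdl.
have en : n = n' * gcdp m n by rewrite divpK ?dvdp_gcdr.
have co : coprimep m' n' by apply: coprimep_div_gcd; rewrite n0 orbT.
have e' : m' ^+ 2 * h = n' ^+ 2 * g.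
  apply: (@mulIf _ (gcdp m n ^+ 2)); first by rewrite expf_neq0.
  by rewrite mulrAC -exprMn -em e {1}en exprMn mulrAC.
have hn : h %| n' ^+ 2 by rewrite -(Gauss_dvdpl _ co_hg) -e' dvdp_mull.
have nh : n' ^+ 2 %| h.
  rewrite -(@Gauss_dvdpr _ _ (m' ^+ 2)) ?e' ?dvdp_mulIl //.
  by rewrite coprimep_expl // coprimep_expr // coprimep_sym.
have sn : size n' == 1%N.
  by apply: contraTT nh => /(separable_nosquare sep_h) ->.
move: hn => /dvdp_leq; rewrite expf_neq0 => [/(_ isT)|]; last first.
  by rewrite -size_poly_eq0 (eqP sn).
move/leq_trans; apply; case/size_poly1P: sn => c _ ->.
by rewrite -rmorphXn size_polyC leq_b1.
Qed.

(** With [q = X^2 + 1] and [X^(2k) + 1 = q h], cancelling [q] leaves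
    [m^2 (a h) = n^2 (b q^(k-1) - a h)]. Here [h] is square-free and prime to [q], hence to the
    right-hand factor, so [h] would be constant, whereas its degree is [2k - 2]. *)
Lemma nonsquare_ratio_poly (m n : {poly F}) (a b : F) k :
  odd k -> (1 < k)%N -> a != 0 -> b != 0 -> n != 0 ->
  m ^+ 2 * (a *: ('X^(2 * k) + 1)) <>
    n ^+ 2 * (b *: ('X^2 + 1) ^+ k - a *: ('X^(2 * k) + 1)).
Proof.
move=> odd_k k_gt1 a0 b0 n0 e.
have szX j : (0 < j)%N -> size ('X^j + 1 : {poly F}) = j.+1 by exact: size_XnaddC.
set q := 'X^2 + 1 : {poly F}; have sq : size q = 3 by exact: szX.
have q0 : q != 0 by rewrite -size_poly_eq0 sq.
(* For odd [k], [X^2 - (-1)] divides [(X^2)^k - (-1)^k]. *)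
have [h eh] : exists h, 'X^(2 * k) + 1 = q * h.
  have := subrXX ('X^2 : {poly F}) (-1) k.
  rewrite -signr_odd odd_k expr1 !opprK -exprM => ->; by eexists.
have szq : size (q * h) = (2 * k).+1 by rewrite -eh szX // muln_gt0 (ltnW k_gt1).
have h0 : h != 0 by apply: contraPneq szq => ->; rewrite mulr0 size_poly0.
have szh : (1 < size h)%N.
  move: szq; rewrite size_mul // sq !addSn add0n /= => /eqP; rewrite eqSS => /eqP sh.
  by rewrite -ltnS sh (leq_trans _ (leq_mul (leqnn 2) k_gt1)).
have := separable_XnD1 (n := 2 * k); rewrite eh separable_mul muln_gt0 (ltnW k_gt1).
case/(_ isT)/and3P=> _ sep_h co_qh.
have ek : k = k.-1.+1 by rewrite prednK // ltnW.
have e' : m ^+ 2 * (a *: h) = n ^+ 2 * (b *: q ^+ k.-1 - a *: h).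
  apply: (mulfI q0); transitivity (m ^+ 2 * (a *: (q * h))).
    by rewrite mulrCA -scalerAr.
  rewrite -eh e eh -/q [RHS]mulrCA [in RHS]mulrBr -!scalerAr.
  by rewrite [in LHS]ek [in q ^+ _.+1]exprS.
suff: (size (a *: h) <= 1)%N by rewrite size_scale // leqNgt szh.
apply: sqr_ratio_coprime n0 e'; first by rewrite (eqp_separable (eqp_scale h a0)).
rewrite addrC -mulN1r coprimep_addl_mul coprimepZl // coprimepZr //.
by rewrite coprimep_expr // coprimep_sym.
Qed.

End SquareFreePoly.

Section RationalFunctions.
Variable F : splittingFieldType rat.

Lemma natF_eq0 (n : nat) : (n%:R == 0 :> F) = (n == 0)%N.
Proof.
rewrite -[n%:R in LHS](rmorph_nat (in_alg F)) fmorph_eq0.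
by rewrite (Num.Theory.pnatr_eq0 rat).
Qed.

(** Putting [alpha = x t], [beta = t] turns both forms of degree [2k] into [t^(2k)] times
    polynomials in [x]; taking leading coefficients in [t] reduces the claim to one variable. *)
Lemma nonsquare_ratio (a b : F) k (w : EF F) :
  odd k -> (1 < k)%N -> a != 0 -> b != 0 ->
  w ^+ 2 * (EF_const a * (alpha ^+ (2 * k) + beta ^+ (2 * k))) <>
    EF_const b * (alpha ^+ 2 + beta ^+ 2) ^+ k
    - EF_const a * (alpha ^+ (2 * k) + beta ^+ (2 * k)).
Proof.
move=> odd_k k_gt1 a0 b0 e; have [m [n [n0 wn]]] := fractionE w.
(* The inner variable is [x], the outer one is [t]. *)
pose tau : {rmorphism {mpoly F[2]} -> {poly {poly F}}} :=
  mmap (polyC \o polyC) (fun i : 'I_2 => if i == 0 then 'X%:P * 'X else 'X).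
have tauC c : tau c%:MP = c%:P%:P by rewrite /tau /= mmapC.
have tau0 : tau 'X_0 = 'X%:P * 'X by rewrite /tau /= mmapX mmap1U.
have tau1 : tau 'X_ord_max = 'X by rewrite /tau /= mmapX mmap1U.
have tau_inj q : tau q = 0 -> q = 0.
  (* Evaluating at [x = alpha / beta], [t = beta] recovers the original polynomial in [EF F], so
     [tau] is injective. *)
  pose back : {rmorphism {poly {poly F}} -> EF F} :=
    horner_eval beta \o map_poly (horner_eval (alpha / beta) \o map_poly EF_const).
  have hC (x y : EF F) : x%:P.[y] = x by exact: hornerC.
  have backE : back \o tau =1 @tofrac _.
    apply: mpoly_hom_ext => [c|i] /=.
      by rewrite tauC map_polyC /= map_polyC; exact: (etrans (hC _ _) (hC _ _)).
    have [->|->] : i = 0 \/ i = ord_max by case: i => [[|[|]]] // ?; [left|right]; apply: val_inj.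
rewrite tau0 rmorphM /=. rewrite map_polyC. rewrite map_polyX /= map_polyX /horner_eval.
      rewrite hornerM. rewrite !hornerC. rewrite !hornerX. rewrite divfK //.
      by rewrite tofrac_eq0 -msupp_eq0 msuppX.
    by rewrite tau1 map_polyX /horner_eval hornerX.
  by move=> q0; apply/eqP; rewrite -tofrac_eq0 -[tofrac q]backE /= q0 !rmorph0.
have {}e : m ^+ 2 * (a%:MP * ('X_0 ^+ (2 * k) + 'X_ord_max ^+ (2 * k))) =
   n ^+ 2 * (b%:MP * ('X_0 ^+ 2 + 'X_ord_max ^+ 2) ^+ k -
     a%:MP * ('X_0 ^+ (2 * k) + 'X_ord_max ^+ (2 * k))).
  apply/eqP; rewrite -tofrac_eq; apply/eqP.
  rewrite !(rmorphXn, rmorphN, rmorphD, rmorphM) /= -wn exprMn mulrAC.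
  rewrite [RHS]mulrC; congr (_ * _). exact: e.
have tauX j : tau ('X_0 ^+ j + 'X_ord_max ^+ j) = ('X^j + 1)%:P * 'X^j.
  by rewrite rmorphD !rmorphXn tau0 tau1 exprMn rmorphD rmorph1 mulrDl mul1r rmorphXn.
have tauA : tau (a%:MP * ('X_0 ^+ (2 * k) + 'X_ord_max ^+ (2 * k))) =
    (a *: ('X^(2 * k) + 1))%:P * 'X^(2 * k).
  by rewrite rmorphM tauC tauX mulrA -polyCM (mul_polyC a).
have tauB : tau (b%:MP * ('X_0 ^+ 2 + 'X_ord_max ^+ 2) ^+ k) =
    (b *: ('X^2 + 1) ^+ k)%:P * 'X^(2 * k).
  by rewrite rmorphM rmorphXn tauC tauX exprMn mulrA -polyC_exp -polyCM (mul_polyC b) -exprM.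
move/(congr1 tau): e; rewrite rmorphM rmorphXn tauA [in RHS]rmorphM rmorphB.
rewrite tauA tauB rmorphXn -mulrBl -polyCB !mulrA.
have X0 : ('X^(2 * k) : {poly {poly F}}) != 0 by rewrite monic_neq0 ?monicXn.
(* The remaining factors are constant in [t], and the leading coefficient of a square is a
   square. *)
move/(mulIf X0)/(congr1 lead_coef).
rewrite [LHS]lead_coefM [RHS]lead_coefM !lead_coefC !lead_coef_exp.
apply: nonsquare_ratio_poly => //.
  by move=> j /eqP; rewrite natF_eq0 => /eqP.
by rewrite lead_coef_eq0; apply: contra n0 => /eqP/tau_inj ->.
Qed.

End RationalFunctions.

(** * Prime ideals and the valuation ring at [P] *)

Section PrimeIdeal.
Variables (R : comPzRingType) (P : R -> Prop).
Hypothesis primeP : is_prime_ideal P.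

Lemma prime_ideal0 : P 0. Proof. by case: primeP => -[]. Qed.
Lemma prime_idealD x y : P x -> P y -> P (x + y).
Proof. by case: primeP => -[_ + _] _ _; apply. Qed.
Lemma prime_idealM a x : P x -> P (a * x).
Proof. by case: primeP => -[_ _ +] _ _; apply. Qed.
Lemma prime_idealN x : P x -> P (- x).
Proof. by rewrite -mulN1r; apply: prime_idealM. Qed.
Lemma prime_idealDr x y : P y -> P (x + y) -> P x.
Proof.
by move=> Py Pxy; rewrite -(addrK y x); apply: prime_idealD => //; apply: prime_idealN.
Qed.
Lemma prime_ideal1 : ~ P 1. Proof. by case: primeP. Qed.
Lemma prime_ideal_mul x y : ~ P x -> ~ P y -> ~ P (x * y).
Proof. by move=> Px Py; case: primeP => _ _ /[apply] -[]. Qed.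
Lemma prime_ideal_sum (I : Type) (r : seq I) (Q : pred I) (f : I -> R) :
  (forall i, Q i -> P (f i)) -> P (\sum_(i <- r | Q i) f i).
Proof.
by move=> Pf; elim/big_ind: _ => //; [exact: prime_ideal0 | exact: prime_idealD].
Qed.
End PrimeIdeal.

(** * Gauss's lemma modulo a prime ideal *)

Section Gauss.
Variables (n : nat) (R : comNzRingType) (P : R -> Prop).
Hypothesis primeP : is_prime_ideal P.
Implicit Types f g : {mpoly R[n]}.

(** A representative of [f] modulo [P] whose nonzero coefficients all lie outside [P], so that
    leading terms can be compared without forming [R / P]. *)
Let high f : {mpoly R[n]} := \sum_(m <- msupp f | ~~ `[< P f@_m >]) f@_m *: 'X_[m].

Let mcoeff_high f k : (high f)@_k = if `[< P f@_k >] then 0 else f@_k.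
Proof.
rewrite raddf_sum /= big_mkcond /=; have [fk|fk] := boolP (k \in msupp f).
  rewrite (bigD1_seq k) ?msupp_uniq //= mcoeffZ mcoeffX eqxx mulr1.
  rewrite if_neg big1 ?addr0 // => m /negbTE mk.
  by rewrite mcoeffZ mcoeffX mk mulr0 if_same.
rewrite (memN_msupp_eq0 fk) if_same big1_seq // => m /andP[_ mf].
rewrite mcoeffZ mcoeffX; case: eqP => [mk|_]; last by rewrite mulr0 if_same.
by rewrite -mk mf in fk.
Qed.

Let mcoeff_low f k : P (f - high f)@_k.
Proof.
rewrite mcoeffB mcoeff_high; case: asboolP => [Pf|_]; first by rewrite subr0.
by rewrite subrr; apply: prime_ideal0.
Qed.

Let mcoeff_mul_ideal f g k : (forall m, P f@_m) -> P (f * g)@_k.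
Proof.
move=> Pf; rewrite mcoeffM; apply: prime_ideal_sum => // i _.
by rewrite mulrC; apply: prime_idealM.
Qed.

Let mlead_high f : (exists m, ~ P f@_m) ->
  ~ P (mleadc (high f)).
Proof.
move=> [m Pfm]; have : mleadc (high f) != 0.
  rewrite mleadc_eq0; apply/eqP => /(congr1 (mcoeff m)).
  rewrite mcoeff_high mcoeff0; case: asboolP => // _ fm0.
  by apply: Pfm; rewrite fm0; apply: prime_ideal0.
by rewrite mcoeff_high; case: asboolP => //; rewrite eqxx.
Qed.

(** At the sum of the leading monomials of [high f] and [high g], the coefficient of [f * g] is
    congruent modulo [P] to the product of the two leading coefficients, which lies outside the
    prime [P]. *)
Lemma mpoly_prime_ideal_mul f g :
  (exists m, ~ P f@_m) -> (exists m, ~ P g@_m) -> exists m, ~ P (f * g)@_m.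
Proof.
move=> /mlead_high Pf /mlead_high Pg.
exists (mlead (high f) + mlead (high g))%MM.
have -> : f * g = high f * high g + ((f - high f) * g + (g - high g) * high f).
  by ring.
rewrite mcoeffD mleadcM => Pfg.
apply: (prime_ideal_mul primeP Pf Pg); apply: (prime_idealDr primeP _ Pfg).
by rewrite mcoeffD; apply: prime_idealD => //; apply: mcoeff_mul_ideal => m; apply: mcoeff_low.
Qed.

Lemma mpoly_prime_ideal_exp f k : (exists m, ~ P f@_m) -> exists m, ~ P (f ^+ k)@_m.
Proof.
move=> Pf; elim: k => [|k IHk]; last by rewrite exprS; apply: mpoly_prime_ideal_mul.
by exists 0%MM; rewrite expr0 mcoeff1 eqxx; apply: prime_ideal1.
Qed.

End Gauss.

(** * Integrality of a root times the leading coefficient *)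

Section IntegralClosure.
Variables (R K : comNzRingType) (f : {rmorphism R -> K}).

Lemma integral_exp x k : integralOver f x -> integralOver f (x ^+ k).
Proof.
move=> ix; elim: k => [|k IHk]; first exact: integral1.
by rewrite exprS; apply: integral_mul.
Qed.

(** With [n] the degree and [c] the leading coefficient of [q], [c^(n-1) q(z)] is a monic polynomial
    in [c z] with the integral lower coefficients [c^(n-1-i) q_i]. *)
Lemma integral_lead_coef_mul (q : {poly K}) z :
  (forall i, integralOver f q`_i) -> root q z -> integralOver f (lead_coef q * z).
Proof.
move=> iq /rootP qz; have [q0|q0] := eqVneq (size q) 0%N.
  by move/eqP: q0; rewrite size_poly_eq0 => /eqP ->; rewrite lead_coef0 mul0r; apply: integral0.
have eq_n : size q = (size q).-1.+1 by rewrite prednK // lt0n.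
set n := (size q).-1 in eq_n; set c := lead_coef q.
pose r := 'X^n + \poly_(i < n) (c ^+ (n - i.+1) * q`_i).
have size_lo : (size (\poly_(i < n) (c ^+ (n - i.+1) * q`_i)%R) < n.+1)%N.
  by rewrite ltnS size_poly.
have mon_r : r \is monic.
  by rewrite monicE lead_coefDl ?lead_coefXn // size_polyXn.
(* In degree 0 the exponent [n - 1] makes no sense; there the root forces [c = 0]. *)
case En : n => [|n'].
  move: qz; rewrite horner_coef eq_n En big_ord1 expr0 mulr1 => c0.
  by rewrite /c lead_coefE eq_n En c0 mul0r; apply: integral0.
apply: (integral_root_monic mon_r).
  rewrite /root hornerD hornerXn horner_poly.
  have := congr1 (fun t => c ^+ n' * t) qz; rewrite mulr0 /= => e; apply/eqP; rewrite -[RHS]e.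
  rewrite horner_coef eq_n big_ord_recr mulrDr addrC; congr (_ + _).
    rewrite mulr_sumr; apply: eq_bigr => i _.
    have lin : (i <= n')%N by rewrite -ltnS -En.
    have -> : (n - i.+1)%N = (n' - i)%N by rewrite -[in RHS]subSS -En.
    have -> : c ^+ n' = c ^+ (n' - i) * c ^+ i by rewrite -exprD subnK.
    by rewrite exprMn /=; ring.
  have -> : (c * z) ^+ n = c * c ^+ n' * z ^+ n by rewrite exprMn En !exprS.
  by rewrite -[q`_ord_max]/(lead_coef q) -/c /=; ring.
apply/integral_poly => i; rewrite coefD coefXn coef_poly; apply: integral_add.
  by case: eqP => _; [exact: integral1 | exact: integral0].
case: ltnP => _; last exact: integral0.
by apply: integral_mul => //; apply: integral_exp; apply: iq.
Qed.

End IntegralClosure.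

Section ValuationRing.
Variables (R : comNzRingType) (K : fieldType) (f : {rmorphism R -> K}) (P : R -> Prop).
Hypothesis primeP : is_prime_ideal P.

(* The (u, u^-1)-lemma: the localization of the integrally closed ring [R] at
   [P] is a valuation ring. One lowers the degree of [q]: the leading
   coefficient [c] has [c * z] in [R], and the term [c * z ^ k] can be replaced
   by [(c * z) * z ^ (k - 1)] when both [c] and [c * z] lie in [P]. *)
Lemma fraction_root
    (lead_coef_mul : forall (q : {poly R}) z, root (map_poly f q) z ->
      exists a, f a = f (lead_coef q) * z)
    (q : {poly R}) (z : K) :
  root (map_poly f q) z -> (exists i, ~ P q`_i) ->
  exists a b   : R, f b * z = f a /\ ~ (P a /\ P b).
Proof.
have [n] := ubnP (size q); elim: n q => // n IHn q size_q qz [i Pqi].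
have [a ea] := lead_coef_mul _ _ qz.
have [[Pa Pc]|nP] := pselect (P a /\ P (lead_coef q)); last by exists a, (lead_coef q).
case Ek : (size q) => [|[|k]].
- by move: Pqi; rewrite nth_default ?Ek // => /(_ (prime_ideal0 primeP)).
- case: Pqi; case: i => [|i]; first by move: Pc; rewrite lead_coefE Ek.
  by rewrite nth_default ?Ek //; apply: prime_ideal0.
have lead_q : lead_coef q = q`_k.+1 by rewrite lead_coefE Ek.
pose q' := q - lead_coef q *: 'X^(k.+1) + a *: 'X^k.
apply: (IHn q').
- rewrite -ltnS; apply: leq_trans size_q; rewrite Ek ltnS.
  apply/leq_sizeP => j jk; have jk0 : (j == k) = false by rewrite gtn_eqF.
  rewrite !coefD coefN !coefZ !coefXn jk0 mulr0 addr0.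
  have [->|j_neq] := eqVneq j k.+1; first by rewrite mulr1 lead_q subrr.
  by rewrite mulr0 subr0 nth_default // Ek ltn_neqAle eq_sym j_neq.
- rewrite /root /q' rmorphD rmorphB /= !map_polyZ !map_polyXn.
  rewrite !hornerD hornerN !hornerZ !hornerXn (rootP qz).
  by rewrite ea exprS; apply/eqP; ring.
- exists i => Pqi'; apply: Pqi.
  rewrite -(addrK (a *: 'X^k - lead_coef q *: 'X^(k.+1))`_i q`_i) -coefD.
  apply: prime_idealD => //; first by move: Pqi'; rewrite /q' -addrA (addrC (- _)).
  apply: prime_idealN => //; rewrite coefB !coefZ; apply: prime_idealD => //.
    by rewrite mulrC; apply: prime_idealM.
  by apply: prime_idealN => //; rewrite mulrC; apply: prime_idealM.
Qed.

Hypothesis inj_f : injective f.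
Hypothesis fracP : forall z, exists a b, f b * z = f a /\ ~ (P a /\ P b).

(** Induction on the number of terms. If [g = x h] is primitive and [x c = a / b] with [a], [b] not
    both in [P], then [a X^m + b g] works for [c X^m + h]: for [b] in [P] its coefficient at [m] is
    [a], and otherwise [b] preserves a coefficient of [g] outside [P]. *)
Lemma mpoly_primitive_multiple n (h : {mpoly K[n]}) : h != 0 ->
  exists (x : K) (g : {mpoly R[n]}), map_mpoly f g = x *: h /\ exists m, ~ P g@_m.
Proof.
elim/mpolyind: h => [|c m h mh c0 IHh _]; first by rewrite eqxx.
have [->|h0] := eqVneq h 0.
  exists c^-1, 'X_[m]; rewrite addr0 scalerA mulVf // scale1r map_mpolyX.
  by split=> //; exists m; rewrite mcoeffX eqxx; apply: prime_ideal1.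
have [x [g [eg [k Pgk]]]] := IHh h0.
have [a [b [eab nab]]] := fracP (x * c).
exists (f b * x), (a *: 'X_[m] + b *: g); split.
  rewrite rmorphD /= !map_mpolyZ map_mpolyX eg -eab scalerDr !scalerA.
  by rewrite mulrA.
have gm : g@_m = 0.
  apply/eqP; rewrite -(inj_eq inj_f) rmorph0 -mcoeff_map_mpoly eg mcoeffZ.
  by rewrite (memN_msupp_eq0 mh) mulr0.
have [Pb|Pb] := pselect (P b).
  exists m; rewrite mcoeffD !mcoeffZ gm mcoeffX eqxx mulr1 mulr0 addr0 => Pa.
  exact: nab.
exists k; rewrite mcoeffD !mcoeffZ mcoeffX; case: eqP => [mk|_].
  by case: Pgk; rewrite -mk gm; apply: prime_ideal0.
by rewrite mulr0 add0r; apply: prime_ideal_mul.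
Qed.

End ValuationRing.

(** * The ring [O_F[1/M]] and its localization at [P] *)

Section NumberRing.
Variables (F : splittingFieldType rat) (M : int).
Hypothesis M0 : M != 0.
Notation O := (OF F M).
Notation OF_set := (subring_gen (fun x : F => is_integral x \/ x = M%:~R^-1)).

Lemma intF_eq0 (k : int) : (k%:~R == 0 :> F) = (k == 0).
Proof.
rewrite -[k%:~R in LHS](rmorph_int (in_alg F)) fmorph_eq0.
by rewrite (intr_eq0 rat).
Qed.

Lemma OF_val_inj : injective (@OF_val F M). Proof. exact: val_inj. Qed.

Lemma OF_val_eq0 (x : O) : (OF_val x == 0) = (x == 0).
Proof. by rewrite -(inj_eq OF_val_inj) rmorph0. Qed.

Lemma coef_map_OF_val (q : {poly O}) i : (map_poly OF_val q)`_i = OF_val q`_i.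
Proof. exact: coef_map. Qed.

(** The elements that become integral after multiplication by a power of [M] form a subring
    containing the generators. *)
Lemma OF_setP (x : F) :
  x \in OF_set <-> exists n, is_integral (x * M%:~R ^+ n).
Proof.
have MF : M%:~R != 0 :> F by rewrite intF_eq0.
have iM n : integralOver (intr : int -> F) (M%:~R ^+ n).
  by apply: integral_exp; apply: integral_id.
split=> [/subring_genP h | [n xM]]; last first.
  rewrite -[x](mulfK (expf_neq0 n MF)); apply: rpredM; first by apply: mem_subring_gen; left.
  by rewrite -exprVn; apply: rpredX; apply: mem_subring_gen; right.
pose A : {pred F} := fun x => `[< exists n, is_integral (x * M%:~R ^+ n) >].
suff : x \in A by move/asboolP.
apply: h => [|y [iy|->]]; last 2 first.
- by apply/asboolP; exists 0%N; rewrite mulr1.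
- by apply/asboolP; exists 1%N; rewrite expr1 mulVf //; apply: integral1.
split=> [|u v /asboolP[k uk] /asboolP[l vl]|u v /asboolP[k uk] /asboolP[l vl]].
- by apply/asboolP; exists 0%N; rewrite mulr1; apply: integral1.
- apply/asboolP; exists (k + l)%N.
  have -> : (u - v) * M%:~R ^+ (k + l) = (u * M%:~R ^+ k) * M%:~R ^+ l
      - (v * M%:~R ^+ l) * M%:~R ^+ k by rewrite exprD; ring.
  apply: integral_sub; apply: integral_mul; first [exact: iM | exact: uk | exact: vl].
- apply/asboolP; exists (k + l)%N.
  have -> : u * v * M%:~R ^+ (k + l) = (u * M%:~R ^+ k) * (v * M%:~R ^+ l).
    by rewrite exprD; ring.
  exact: integral_mul.
Qed.

Lemma OF_lead_coef_mul (q : {poly O}) (z : F) :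
  root (map_poly OF_val q) z -> exists a : O, OF_val a = OF_val (lead_coef q) * z.
Proof.
move=> qz; suff h : OF_val (lead_coef q) * z \in OF_set by exists (Subring h).
have MF : M%:~R != 0 :> F by rewrite intF_eq0.
have /choice[e eP] : forall i, exists n, is_integral (OF_val q`_i * M%:~R ^+ n).
  by move=> i; apply/OF_setP; apply: subring_valP.
have lead_q : lead_coef (map_poly OF_val q) = OF_val (lead_coef q).
  by apply: lead_coef_map_inj; [exact: OF_val_inj | exact: rmorph0].
(* [M^N] clears the denominators of all coefficients of [q] at once. *)
pose N := \sum_(i < size q) e i.
apply/OF_setP; exists N.
have -> : OF_val (lead_coef q) * z * M%:~R ^+ N =
    lead_coef (M%:~R ^+ N *: map_poly OF_val q) * z.
  by rewrite lead_coefZ lead_q mulrC mulrA.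
apply: integral_lead_coef_mul; last by rewrite /root hornerZ (rootP qz) mulr0.
move=> i; rewrite coefZ coef_map_OF_val; have [iq|iq] := ltnP i (size q); last first.
  by rewrite nth_default // rmorph0 mulr0; apply: integral0.
rewrite /N (bigD1 (Ordinal iq)) //= exprD mulrAC [_ * OF_val _]mulrC.
apply: integral_mul; first exact: eP.
by apply: integral_exp; apply: integral_id.
Qed.

Variables (p : nat) (P : O -> Prop).
Hypotheses (prime_p : prime p) (primeP : is_prime_ideal P) (Pp : P p%:R).

(** Otherwise a Bezout relation between [p] and [k] puts 1 into [P]. *)
Lemma prime_ideal_int (k : int) : P k%:~R -> (p %| k)%Z.
Proof.
move=> Pk; apply/negP => pk.
have /coprimezP[[u v] /= uv] : coprimez p k.
  by rewrite coprimezE prime_coprime //; apply/negP => pk'; apply: pk; rewrite dvdzE.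
apply: (prime_ideal1 primeP); rewrite -[1](rmorph1 (intr : int -> O)) -uv.
by rewrite rmorphD !rmorphM; apply: prime_idealD => //; apply: prime_idealM.
Qed.

(** The minimal polynomial of [z] over the rationals has a primitive integral multiple. Not all its
    coefficients are divisible by [p], so some coefficient is outside [P] and [fraction_root]
    applies. *)
Lemma OF_fraction (z : F) :
  exists a b : O, OF_val b * z = OF_val a /\ ~ (P a /\ P b).
Proof.
have /polyOver1P[r er] := minPolyOver 1 z.
have [q [a a0 rq]] := rat_poly_scale r.
have q0 : q != 0.
  apply: contraTneq (monic_minPoly 1 z) => q0; rewrite er rq q0.
  by rewrite rmorph0 scaler0 rmorph0 monicE lead_coef0 eq_sym oner_eq0.
pose s := map_poly (intr : int -> O) (zprimitive q).
apply: (fraction_root primeP OF_lead_coef_mul (q := s)).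
  have : root (map_poly (intr : int -> F) (zprimitive q)) z.
    have := root_minPoly 1 z; rewrite er rq map_polyZ rootZ; last first.
      by rewrite fmorph_eq0 invr_eq0 intr_eq0.
    rewrite -map_poly_comp [map_poly _ q](_ : _ = map_poly (intr : int -> F) q).
      by rewrite [in map_poly _ q](zpolyEprim q) map_polyZ rootZ // intF_eq0 zcontents_eq0.
    by apply: eq_map_poly => c; exact: (rmorph_int (in_alg F)).
  congr (root _ _); symmetry; rewrite /s -[LHS]map_poly_comp; apply: eq_map_poly => c.
  exact: (rmorph_int OF_val).
apply/not_existsP => h.
have : (p %| zcontents (zprimitive q))%Z.
  rewrite dvdz_contents; apply/polyOverP => i; apply: prime_ideal_int.
  by have := contrapT (h i); rewrite /s coef_map.
by rewrite zcontents_primitive q0 dvdzE /= dvdn1 => /eqP p1; move: (prime_p); rewrite p1.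
Qed.

End NumberRing.

(** * The coordinate ring of [G'] *)

(** The inner binomial coefficients are divisible by [p]. No field or domain structure is assumed,
    as the lemma serves [B' / P B']. *)
Lemma exprDn_prime (T : comPzRingType) (p : nat) : prime p -> p%:R = 0 :> T ->
  forall x y : T, (x + y) ^+ p = x ^+ p + y ^+ p.
Proof.
case: p => // q pr_p p0 x y.
rewrite exprDn big_ord_recl big_ord_recr /= big1 => [|i _].
  by rewrite /bump /= !add1n subn0 subnn !expr0 binn bin0 mulr1 mul1r add0r.
rewrite /bump /= add1n -mulr_natr.
have /dvdnP[k ->] : (q.+1 %| 'C(q.+1, i.+1))%N by apply: prime_dvd_bin => //=; exact: ltn_ord.
by rewrite natrM p0 !mulr0.
Qed.

Section CoordinateRing.
Variables (F : splittingFieldType rat) (M : int).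
Notation O := (OF F M).
Notation B := (BF F M).
Notation OP := {mpoly O[2]}.

(** [B'] is studied as the localization of [O[alpha, beta]] at [alpha^2 + beta^2]: [OP_EF] and
    [OP_BF] are the inclusions of this polynomial ring into [E'] and [B']. *)
Definition OP_EF : {rmorphism OP -> EF F} := @tofrac _ \o map_mpoly OF_val.

Definition OP_BF : {rmorphism OP -> B} :=
  mmap BF_const (fun i : 'I_2 => if i == ord0 then alphaB else betaB).

Definition OP_norm : OP := 'X_ord0 ^+ 2 + 'X_ord_max ^+ 2.

Lemma ord2_cases (i : 'I_2) : i = ord0 \/ i = ord_max.
Proof. by case: i => [[|[|]]] // ?; [left | right]; apply: val_inj. Qed.

Lemma OP_BFC c : OP_BF c%:MP = BF_const c. Proof. exact: mmapC. Qed.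
Lemma OP_BF0 : OP_BF 'X_ord0 = alphaB. Proof. by rewrite /OP_BF /= mmapX mmap1U. Qed.
Lemma OP_BF1 : OP_BF 'X_ord_max = betaB. Proof. by rewrite /OP_BF /= mmapX mmap1U. Qed.

Lemma OP_EFC c : OP_EF c%:MP = EF_const (OF_val c).
Proof. exact: (congr1 (fun f : {mpoly F[2]} => tofrac f) (@map_mpolyC 2 O F OF_val c)). Qed.
Lemma OP_EFX i : OP_EF 'X_i = tofrac 'X_i.
Proof. exact: (congr1 (fun f : {mpoly F[2]} => tofrac f) (@map_mpolyX 2 O F OF_val U_(i))). Qed.

Lemma OP_EF_inj : injective OP_EF.
Proof.
move=> f g /eqP; rewrite /OP_EF /= tofrac_eq => /eqP e; apply/mpolyP => m.
by apply: OF_val_inj; rewrite -!mcoeff_map_mpoly e.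
Qed.

Lemma BF_val_inj : injective (@BF_val F M). Proof. exact: val_inj. Qed.

Lemma BF_val_OP : BF_val \o OP_BF =1 OP_EF.
Proof.
apply: mpoly_hom_ext => [c|i]; first by rewrite OP_EFC /= OP_BFC.
by case: (ord2_cases i) => ->; rewrite OP_EFX /= ?OP_BF0 ?OP_BF1.
Qed.

Lemma OP_BF_inj : injective OP_BF.
Proof. by move=> f g e; apply: OP_EF_inj; rewrite -!BF_val_OP /= e. Qed.

Lemma OP_norm_neq0 : OP_norm != 0.
Proof.
apply/eqP => /(congr1 (mcoeff (U_(ord0) *+ 2)%MM)).
rewrite /OP_norm !mpolyXn mcoeffD !mcoeffX eqxx mcoeff0.
case: eqP => [/(congr1 (fun m : 'X_{1..2} => m ord0))|_].
  by rewrite !mulmnE !mnm1E.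
by rewrite addr0 => /eqP; rewrite oner_eq0.
Qed.

Lemma OP_norm_coef : OP_norm@_(U_(ord0) *+ 2) = 1.
Proof.
rewrite /OP_norm !mpolyXn mcoeffD !mcoeffX eqxx.
case: eqP => [/(congr1 (fun m : 'X_{1..2} => m ord0))|_]; last by rewrite addr0.
by rewrite !mulmnE !mnm1E.
Qed.

Lemma OP_EF_norm : OP_EF OP_norm = alpha ^+ 2 + beta ^+ 2.
Proof. by rewrite rmorphD !rmorphXn !OP_EFX. Qed.

(** Elements of [E'] that become polynomials after multiplication by a power of [alpha^2 + beta^2]
    form a subring containing the generators of [B']. *)
Lemma BF_frac (x : B) : exists g n, x * OP_BF (OP_norm ^+ n) = OP_BF g.
Proof.
have N0 : OP_EF OP_norm != 0.
  by rewrite -(rmorph0 OP_EF) (inj_eq OP_EF_inj) OP_norm_neq0.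
pose A : {pred EF F} :=
  fun x => `[< exists g n, x * OP_EF OP_norm ^+ n = OP_EF g >].
suff : BF_val x \in A.
  move=> /asboolP[g [n e]]; exists g, n; apply: BF_val_inj.
  by rewrite rmorphM ![BF_val (OP_BF _)]BF_val_OP rmorphXn.
have /subring_genP := subring_valP x; apply.
  split=> [|u v /asboolP[f [k ek]] /asboolP[g [l el]]
           |u v /asboolP[f [k ek]] /asboolP[g [l el]]].
  - by apply/asboolP; exists 1, 0%N; rewrite mulr1 rmorph1.
  - apply/asboolP; exists (f * OP_norm ^+ l - g * OP_norm ^+ k), (k + l)%N.
    by rewrite rmorphB !rmorphM !rmorphXn -ek -el exprD; ring.
  - apply/asboolP; exists (f * g), (k + l)%N.
    by rewrite rmorphM -ek -el exprD; ring.
move=> y [[c ->]|->|->|->]; apply/asboolP.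
- by exists c%:MP, 0%N; rewrite mulr1 OP_EFC.
- by exists 'X_ord0, 0%N; rewrite mulr1 OP_EFX.
- by exists 'X_ord_max, 0%N; rewrite mulr1 OP_EFX.
- by exists 1, 1%N; rewrite -OP_EF_norm expr1 mulVf // rmorph1.
Qed.

Lemma OP_BF_norm_invertible : invertible (OP_BF OP_norm).
Proof.
have inN : (alpha ^+ 2 + beta ^+ 2)^-1 \in subring_gen (@BF_gen F M).
  by apply: mem_subring_gen; apply: Or44.
exists (Subring inN); apply: BF_val_inj; rewrite rmorphM rmorph1 [BF_val (OP_BF _)]BF_val_OP.
rewrite [BF_val (Subring _)]/= OP_EF_norm mulfV // -OP_EF_norm.
by rewrite -(rmorph0 OP_EF) (inj_eq OP_EF_inj) OP_norm_neq0.
Qed.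

Section Lift.
Variable T : comPzRingType.

Lemma BF_lift (h : {rmorphism OP -> T}) : invertible (h OP_norm) ->
  exists k : {rmorphism B -> T}, k \o OP_BF =1 h.
Proof.
move=> hN; apply: frac_ext => [x|a a0].
  have [g [n e]] := BF_frac x; exists g, (OP_norm ^+ n); split=> //.
  by rewrite rmorphXn; apply: invertibleX.
have -> : a = 0 by apply: OP_BF_inj; rewrite a0 rmorph0.
exact: rmorph0.
Qed.

End Lift.

Variables (p : nat) (P : O -> Prop) (phi : gal_of {:F}).
Hypotheses (M0 : M != 0) (prime_p : prime p) (primeP : is_prime_ideal P).
Hypotheses (Pp : P p%:R) (frob_phi : is_frobenius P p phi).

Lemma scale_OP (f : {mpoly F[2]}) : f != 0 ->
  exists x (g : OP), OP_EF g = EF_const x * tofrac f /\ exists m, ~ P g@_m.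
Proof.
move=> f0.
have [x [g [eg Pg]]] :=
  mpoly_primitive_multiple primeP (@OF_val_inj F M) (OF_fraction M0 prime_p primeP Pp) f0.
by exists x, g; split=> //; rewrite /OP_EF /= eg -mul_mpolyC rmorphM.
Qed.

Lemma EF_frac (x : EF F) : exists a b : B, BF_val b != 0 /\ x * BF_val b = BF_val a.
Proof.
have [m [n [n0 xnm]]] := fractionE x.
have [m0|m0] := eqVneq m 0.
  exists 0, 1; rewrite rmorph1 oner_eq0 mulr1 rmorph0; split=> //.
  by apply/eqP; move/eqP: xnm; rewrite m0 rmorph0 mulf_eq0 tofrac_eq0 (negbTE n0) orbF.
have [xm [gm [em [km Pkm]]]] := scale_OP m0; have [xn [gn [en [k Pk]]]] := scale_OP n0.
have gn0 : OP_EF gn != 0.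
  apply/eqP => /eqP; rewrite -(rmorph0 OP_EF) (inj_eq OP_EF_inj) => /eqP gn0.
  by apply: Pk; rewrite gn0 mcoeff0; apply: prime_ideal0.
have xm0 : xm != 0.
  apply: contraPneq Pkm => xm0; apply; rewrite (_ : gm = 0) ?mcoeff0; first exact: prime_ideal0.
  by apply: OP_EF_inj; rewrite em xm0 !rmorph0 mul0r.
(* Since [x = (gm / gn) (xn / xm)], it remains to write the scalar [xn / xm] as a fraction over
   [O]. *)
have [a [b [eab nab]]] := OF_fraction M0 prime_p primeP Pp (xn / xm).
have b0 : OF_val b != 0.
  rewrite OF_val_eq0; apply/eqP => b0; apply: nab; rewrite b0.
  suff -> : a = 0 by split; apply: prime_ideal0.
  by apply: OF_val_inj; rewrite -eab b0 rmorph0 mul0r.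
exists (OP_BF gm * BF_const a), (OP_BF gn * BF_const b).
have bE : EF_const (OF_val b) != 0 by rewrite fmorph_eq0.
have xmE : EF_const xm != 0 by rewrite fmorph_eq0.
have valM g c : BF_val (OP_BF g * BF_const c) = OP_EF g * EF_const (OF_val c).
  by rewrite rmorphM [BF_val (OP_BF _)]BF_val_OP.
rewrite !valM; split; first exact: (mulf_neq0 gn0 bE).
rewrite en em -xnm -eab !rmorphM fmorphV.
have gen (K : fieldType) (r t u v w : K) :
  u != 0 -> r * (w * t * v) = u * (r * t) * (v * (w / u)) by move=> u0; field.
exact: gen.
Qed.

(** The elements that a power of [alpha^2 + beta^2] carries into polynomials with coefficients in
    [P] form an ideal containing [P]. Gauss's lemma keeps [g] out of it, as [alpha^2 + beta^2] has a
    coefficient 1. *)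
Lemma quot_OP_neq0 (g : OP) : (exists m, ~ P g@_m) ->
  quot_pi (fun x : B => exists2 c : O, P c & x = BF_const c) (OP_BF g) <> 0.
Proof.
move=> Pg /quot_pi_eq0 gP.
pose I (x : B) := exists f n, (forall m, P f@_m) /\ x * OP_BF (OP_norm ^+ n) = OP_BF f.
have mulP (f h : OP) : (forall m, P f@_m) -> forall m, P (h * f)@_m.
  move=> Pf m; rewrite mcoeffM; apply: prime_ideal_sum => // i _.
  by apply: prime_idealM.
have [||f [n [Pf ef]]] := gP I.
- split=> [|x y [f [k [Pf ef]]] [h [l [Ph eh]]]|a x [f [k [Pf ef]]]].
  + exists 0, 0%N; rewrite rmorph0 mul0r; split=> // m.
    by rewrite mcoeff0; apply: prime_ideal0.
  + exists (OP_norm ^+ l * f + OP_norm ^+ k * h), (k + l)%N; split=> [m|].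
      by rewrite mcoeffD; apply: prime_idealD => //; apply: mulP.
    by rewrite rmorphD !rmorphM -ef -eh exprD rmorphM; ring.
  + have [b [l eb]] := BF_frac a; exists (b * f), (k + l)%N; split=> [m|].
      exact: mulP.
    by rewrite rmorphM -eb -ef exprD rmorphM; ring.
- move=> _ [c Pc ->]; exists c%:MP, 0%N; rewrite rmorph1 mulr1 OP_BFC; split=> // m.
  by rewrite mcoeffC mulrC; apply: prime_idealM.
have {}ef : g * OP_norm ^+ n = f by apply: OP_BF_inj; rewrite rmorphM.
have [||m] := @mpoly_prime_ideal_mul _ _ _ primeP g (OP_norm ^+ n) => //.
  apply: mpoly_prime_ideal_exp => //; exists (U_(ord0) *+ 2)%MM.
  by rewrite OP_norm_coef; apply: prime_ideal1.
by rewrite ef.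
Qed.

(** The [p]-th power map is additive modulo [P], so agreement on constants, given by the Frobenius
    property of [phi], and on the variables suffices. *)
Lemma BmodP_frobenius (h : {rmorphism OP -> BmodP P}) :
  (forall c, h c%:MP = quot_pi _ (BF_const (gal_OF phi c))) ->
  (forall i, h 'X_i = quot_pi _ (OP_BF 'X_i) ^+ p) ->
  forall g, h g = quot_pi _ (OP_BF g ^+ p).
Proof.
move=> hC hX.
have p0 : p%:R = 0 :> BmodP P.
  rewrite -(rmorph_nat (quot_pi _)); apply: quot_pi_gen; exists p%:R => //.
  by rewrite rmorph_nat.
have frobD := exprDn_prime prime_p p0.
elim/mpolyind => [|c m g _ _ IHg].
  by rewrite !rmorph0 expr0n; case: (p) prime_p => // p' _; rewrite rmorph0.
rewrite rmorphD IHg rmorphD /= !rmorphXn rmorphD frobD; congr (_ + _).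
rewrite -mul_mpolyC !rmorphM exprMn OP_BFC hC; congr (_ * _).
  rewrite -rmorphXn -rmorphXn; apply/quot_piP; rewrite -rmorphB => I _; apply.
  by exists (gal_OF phi c - c ^+ p); first exact: frob_phi.
rewrite mpolyXE_id !rmorph_prod -prodrXl; apply: eq_bigr => i _.
by rewrite !rmorphXn hX exprAC.
Qed.

End CoordinateRing.

(** * The canonical correspondences *)

Lemma ord2P (i : 'I_2) : i = 0 \/ i = 1.
Proof. by case: i => [[|[|]]] // ?; [left | right]; apply: val_inj. Qed.

Section Matrix2.
Variable T : comPzRingType.
Implicit Types (X Y : 'M[T]_2) (u v w : T).

Lemma matrix2P X Y : X 0 0 = Y 0 0 -> X 0 1 = Y 0 1 -> X 1 0 = Y 1 0 ->
  X 1 1 = Y 1 1 -> X = Y.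
Proof.
by move=> *; apply/matrixP => i j; case: (ord2P i) (ord2P j) => -> [] ->.
Qed.

Lemma sum2E (f : 'I_2 -> T) : \sum_i f i = f 0 + f 1.
Proof. by rewrite big_ord_recl big_ord1; congr (_ + f _); apply: val_inj. Qed.

Lemma mulmx2E X Y i j : (X *m Y) i j = X i 0 * Y 0 j + X i 1 * Y 1 j.
Proof. by rewrite mxE sum2E. Qed.

Lemma cmx00 u v : cmx u v 0 0 = u. Proof. by rewrite mxE. Qed.
Lemma cmx01 u v : cmx u v 0 1 = v. Proof. by rewrite mxE. Qed.
Lemma cmx10 u v : cmx u v 1 0 = - v. Proof. by rewrite mxE. Qed.
Lemma cmx11 u v : cmx u v 1 1 = u. Proof. by rewrite mxE. Qed.
Definition cmxE := (cmx00, cmx01, cmx10, cmx11).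

Lemma scalar2E u : (u%:M : 'M[T]_2) = cmx u 0.
Proof. by apply: matrix2P; rewrite !cmxE !mxE ?oppr0. Qed.

Lemma det2E X : \det X = X 0 0 * X 1 1 - X 0 1 * X 1 0.
Proof.
rewrite (expand_det_row _ 0) sum2E /cofactor !det_mx11 !mxE /= expr0 mul1r expr1.
rewrite mulN1r mulrN; congr (_ * X _ _ - _ * X _ _); exact: val_inj.
Qed.

(** By the Lagrange identity the determinant has square [t^2]; invertibility of determinant plus [t]
    selects the value [t], and the two conclusions follow after multiplication by [t]. *)
Lemma conformal2 (A B C E t : T) :
  A ^+ 2 + C ^+ 2 = t -> B ^+ 2 + E ^+ 2 = t -> A * B + C * E = 0 ->
  invertible t -> invertible (A * E - B * C + t) -> E = A /\ C = - B.
Proof.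
move=> eAC eBE eAB ut ud.
have dt : A * E - B * C = t.
  apply/eqP; rewrite -subr_eq0; apply/eqP; apply: (invertible_mulI ud).
  rewrite mulr0; transitivity ((A ^+ 2 + C ^+ 2) * (B ^+ 2 + E ^+ 2)
    - (A * B + C * E) ^+ 2 - t ^+ 2); first by ring.
  by rewrite eAC eBE eAB; ring.
have AB : A * B = - (C * E) by apply/eqP; rewrite -subr_eq0 opprK eAB.
split; apply: (invertible_mulI ut).
  rewrite -{1}dt -eBE; transitivity (A * B * B + A * E ^+ 2); last by ring.
  by rewrite AB; ring.
rewrite -{1}dt -eAC; transitivity (- (A * (A * B) + B * C ^+ 2)); last by ring.
by rewrite AB; ring.
Qed.

(* With [y_i = [[A_i, B_i], [C_i, E_i]]], orthogonality up to the factor [t]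
   and [det y_i = t] force [E_i = A_i] and [C_i = - B_i]; the torsion-free
   relation then gives [A_2 = 1 + B_1] and [B_2 = 1 - A_1], and comparing
   [A_1^2 + B_1^2 = t = A_2^2 + B_2^2] yields [A_1 = 1 + B_1]. *)
Lemma canonical_pair (Y : 'I_2 -> 'M[T]_2) (a b t : T) :
  invertible (2%:R : T) -> invertible a -> invertible b -> a * t = b ->
  (forall i, (Y i)^T *m a%:M *m Y i = b%:M) ->
  (forall i, invertible (\det (Y i) + t)) ->
  (forall k, a * (Y 0 - 1%:M) k 1 = a * (Y 1 - 1%:M) k 0) ->
  let v := Y 0 0 1 in
  Y 0 = cmx (1 + v) v /\ Y 1 = cmx (1 + v) (- v).
Proof.
move=> u2 ua ub at_b gram udet tors v.
have ut : invertible t by rewrite -at_b in ub; apply: invertible_mulr ub.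
have conf i : Y i = cmx (Y i 0 0) (Y i 0 1) /\ Y i 0 0 ^+ 2 + Y i 0 1 ^+ 2 = t.
  have gr j k : Y i 0 j * Y i 0 k + Y i 1 j * Y i 1 k = t * (j == k)%:R.
    have := congr1 (fun X => X j k) (gram i).
    rewrite mul_mx_scalar -scalemxAl !mxE sum2E !mxE -at_b => e.
    by apply: (invertible_mulI ua); rewrite e mulr_natr mulrnAr.
  have [|||||eE eC] := @conformal2 (Y i 0 0) (Y i 0 1) (Y i 1 0) (Y i 1 1) t.
  - by rewrite !expr2 gr mulr1.
  - by rewrite !expr2 gr mulr1.
  - by rewrite gr mulr0.
  - by [].
  - by rewrite -det2E.
  split; first by apply: matrix2P; rewrite !cmxE.
  by rewrite -(mulr1 t) -(gr 0 0) eC; ring.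
have tors' k := invertible_mulI ua (tors k).
have [Y0 n0] := conf 0; have [Y1 n1] := conf 1.
have := tors' 1; have := tors' 0; rewrite !mxE /= !mulr0n !mulr1n !subr0 => e0 e1.
have Y100 : Y 1 0 0 = 1 + v by rewrite [v]e0; ring.
have Y101 : Y 1 0 1 = 1 - Y 0 0 0.
  have Y11 : Y 0 1 1 = Y 0 0 0.
    by have := congr1 (fun X : 'M[T]_2 => X 1 1) Y0; rewrite cmx11.
  have Y10 : Y 1 1 0 = - Y 1 0 1.
    by have := congr1 (fun X : 'M[T]_2 => X 1 0) Y1; rewrite cmx10.
  by rewrite -[LHS]opprK -Y10 -e1 Y11; ring.
have eA : Y 0 0 0 = 1 + v.
  (* Equality of the two norms reads [2 A_1 = 2 (1 + v)]; this is where 2 must be invertible. *)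
  apply: (invertible_mulI u2); move: n1; rewrite -n0 Y100 Y101 -/v => e.
  apply/eqP; rewrite -subr_eq0; apply/eqP.
  by rewrite -[RHS](subrr ((Y 0 0 0) ^+ 2 + v ^+ 2)) -{2}e; ring.
rewrite Y0 Y1 Y100 Y101 eA -/v; split=> //.
by congr cmx; ring.
Qed.

End Matrix2.

Lemma prod2E (T : comPzRingType) (f : 'I_2 -> T) : \prod_i f i = f 0 * f 1.
Proof. by rewrite big_ord_recl big_ord1; congr (_ * f _); apply: val_inj. Qed.

Lemma Bpoly_lift (F : splittingFieldType rat) (M : int) (T : comNzRingType)
    (f : {rmorphism BF F M -> T}) (Y : 'I_2 -> 'M[T]_2) :
  exists h : {rmorphism Bpoly F M -> T},
    (forall c, h c%:MP = f c) /\ forall i, map_mx h (yX F M i) = Y i.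
Proof.
pose y (n : 'I_#|Yvar|) : T := let: (i, j, k) := enum_val n in Y i j k.
exists (mmap f y); split=> [c|i]; first exact: mmapC.
by apply/matrixP => j k; rewrite !mxE /= mmapX mmap1U /y enum_rankK.
Qed.

Lemma cmx_gram (T : comPzRingType) (u v a : T) :
  (cmx u v)^T *m a%:M *m cmx u v = (a * (u ^+ 2 + v ^+ 2))%:M.
Proof.
rewrite mul_mx_scalar -scalemxAl.
apply: matrix2P; rewrite [LHS]mxE mulmx2E ![_^T _ _]mxE !cmxE [RHS]mxE /=.
all: by rewrite ?mulr1n ?mulr0n; ring.
Qed.

Section MapMatrix.
Variables (R S : comPzRingType) (f : {rmorphism R -> S}).

Lemma map_mx_gram n (Y : 'M[R]_n) a b : Y^T *m a%:M *m Y = b%:M ->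
  (map_mx f Y)^T *m (f a)%:M *m map_mx f Y = (f b)%:M.
Proof. by move=> e; rewrite -!map_scalar_mx -e !map_mxM map_trmx. Qed.

Lemma map_mx_gram_sub n (Y : 'M[R]_n) a b :
  map_mx f (Y^T *m a%:M *m Y - b%:M) =
  (map_mx f Y)^T *m (f a)%:M *m map_mx f Y - (f b)%:M.
Proof. by rewrite map_mxB !map_mxM map_trmx !map_scalar_mx. Qed.

Lemma rmorph_scalar_mul n (Y : 'M[R]_n) a i j :
  f ((a%:M *m (Y - 1%:M)) i j) = f a * (map_mx f Y - 1%:M) i j.
Proof.
by rewrite mul_scalar_mx -(rmorph1 f) -(map_scalar_mx f) -map_mxB !mxE rmorphM.
Qed.

Lemma rmorph_tr_det n (Y : 'M[R]_n) t :
  f (\tr Y * (\det Y + t)) = \tr (map_mx f Y) * (\det (map_mx f Y) + f t).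
Proof. by rewrite rmorphM rmorphD trace_map_mx det_map_mx. Qed.

Lemma rmorph_det2_mul (Y Z : 'M[R]_2) :
  let Y' := map_mx f Y in let Z' := map_mx f Z in
  f (\det Y * \det Z * (Y 0 1 * Z 1 0 - Z 0 0 * Y 1 1)) =
  \det Y' * \det Z' * (Y' 0 1 * Z' 1 0 - Z' 0 0 * Y' 1 1).
Proof. by rewrite /= !rmorphM rmorphB !rmorphM !det_map_mx !mxE. Qed.

Lemma map_mx_torsion n (Y Z : 'M[R]_n) a i j k :
  a * (Y - 1%:M) i j = a * (Z - 1%:M) i k ->
  f a * (map_mx f Y - 1%:M) i j = f a * (map_mx f Z - 1%:M) i k.
Proof.
move=> /(congr1 f); rewrite !rmorphM.
have e X l : f ((X - 1%:M : 'M[R]_n) i l) = (map_mx f X - 1%:M) i l.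
  by rewrite -(rmorph1 f) -map_scalar_mx -map_mxB [RHS]mxE.
by rewrite !e.
Qed.

Lemma map_mx_det_add n (Y : 'M[R]_n) t : \det (map_mx f Y) + f t = f (\det Y + t).
Proof. by rewrite det_map_mx rmorphD. Qed.

Lemma invertible_rmorph_factors s w x y z : s = w * x * (y * z) -> invertible (f s) ->
  invertible (f x) /\ invertible (f z).
Proof.
move=> -> h; split.
  by apply: (@invertible_mull _ _ (f w * f (y * z))); rewrite mulrCA mulrA -!rmorphM.
by apply: (@invertible_mull _ _ (f (w * x) * f y)); rewrite mulrC -mulrA -!rmorphM.
Qed.

End MapMatrix.

(** * Localization, quotient and second localization combined *)

Section LocQuotLoc.
Variables (R : comPzRingType) (s : R) (S : loc s -> Prop) (t : quot S).

(** The shape in which [C'_s] arises from the polynomial ring over [B']. *)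
Definition loc_quot_loc : {rmorphism R -> loc t} := loc_map t \o (quot_pi S \o loc_map s).

Lemma loc_quot_loc_invertible : invertible (loc_quot_loc s).
Proof.
apply: (invertible_rmorph (loc_map t)); apply: (invertible_rmorph (quot_pi S)).
exact: loc_map_invertible.
Qed.

Lemma loc_quot_loc_frac (x : loc t) :
  exists q w, x * loc_quot_loc w = loc_quot_loc q /\ invertible (loc_quot_loc w).
Proof.
have [c [n ec]] := loc_fracE x.
have lift (c' : quot S) : exists q w,
    c' * quot_pi S (loc_map s w) = quot_pi S (loc_map s q) /\ invertible (loc_quot_loc w).
  have [e ->] := quot_pi_surj c'; have [q [m eq]] := loc_fracE e.
  exists q, (s ^+ m); split; first by rewrite -eq rmorphM.
  by rewrite rmorphXn; apply: invertibleX; apply: loc_quot_loc_invertible.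
have [q [w [eqw uw]]] := lift c; have [r [v [erv uv]]] := lift (t ^+ n).
have ur : invertible (loc_quot_loc r).
  rewrite /= -erv rmorphM; apply: invertibleM uv.
  by rewrite rmorphXn; apply/invertibleX/loc_map_invertible.
exists (q * v), (r * w); split; last by rewrite rmorphM; apply: invertibleM.
by rewrite !rmorphM /= -erv -eqw !rmorphM /= -ec; ring.
Qed.

(** [S] and [t] live in intermediate rings, so their conditions are put on the successive extensions
    of [h]. *)
Lemma loc_quot_loc_lift (T : comPzRingType) (h : {rmorphism R -> T}) :
  invertible (h s) ->
  (forall h1 : {rmorphism loc s -> T}, h1 \o loc_map s =1 h ->
     forall x, S x -> h1 x = 0) ->
  (forall h2 : {rmorphism quot S -> T}, h2 \o (quot_pi S \o loc_map s) =1 h ->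
     invertible (h2 t)) ->
  exists k : {rmorphism loc t -> T}, k \o loc_quot_loc =1 h.
Proof.
move=> hs hS ht; have [h1 e1] := loc_lift hs; have [h2 e2] := quot_lift (hS h1 e1).
have e2' : h2 \o (quot_pi S \o loc_map s) =1 h.
  by move=> x; rewrite -e1 -[RHS]e2.
have [k ek] := loc_lift (ht h2 e2'); exists k => x.
by rewrite -e2' -[RHS]ek.
Qed.

End LocQuotLoc.

(** * Relations and universal property of [C'_s] *)

Section CanonicalRing.
Variables (F : splittingFieldType rat) (M : int) (p : nat) (phi : gal_of {:F}).
Variables (d : OF F M) (d_ : 'I_2 -> OF F M).
Hypothesis d_E : forall i, d_ i = d.
Notation O := (OF F M).
Notation B := (BF F M).
Notation Cs := (Cs p phi d_).
Notation C' := (C' p phi d_).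

(* Locked: otherwise rewriting with [rmorphM] unfolds them. *)
Definition aB : B :=
  locked ((alphaB ^+ (2 * p) + betaB ^+ (2 * p)) * BF_const (gal_OF phi d)).
Definition bB : B := locked ((alphaB ^+ 2 + betaB ^+ 2) ^+ p * BF_const d ^+ p).

Lemma aB_def : aB = (alphaB ^+ (2 * p) + betaB ^+ (2 * p)) * BF_const (gal_OF phi d).
Proof. by rewrite /aB -lock. Qed.

Lemma bB_def : bB = (alphaB ^+ 2 + betaB ^+ 2) ^+ p * BF_const d ^+ p.
Proof. by rewrite /bB -lock. Qed.

Lemma aBE i : a_ p phi d_ i = aB. Proof. by rewrite /a_ d_E aB_def. Qed.
Lemma bBE i : b_ p d_ i = bB. Proof. by rewrite /b_ d_E bB_def. Qed.

Definition Bpoly_C' : {rmorphism Bpoly F M -> C'} :=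
  @quot_pi _ (@Crel F M p phi d_) \o
  @loc_map (Bpoly F M) ((b_ p d_ 0 * b_ p d_ 1)%:MP * DX F M).
Definition Bpoly_Cs : {rmorphism Bpoly F M -> Cs} :=
  @loc_quot_loc (Bpoly F M) ((b_ p d_ 0 * b_ p d_ 1)%:MP * DX F M) (@Crel F M p phi d_)
    (sC' p phi d_).

Lemma Bpoly_CsC c : Bpoly_Cs c%:MP = pi' p phi d_ c. Proof. by []. Qed.

Lemma ysE i : ys p phi d_ i = map_mx Bpoly_Cs (yX F M i).
Proof. by apply/matrixP => j k; rewrite !mxE. Qed.

Lemma Cs_frac (x : Cs) : exists q w, x * Bpoly_Cs w = Bpoly_Cs q /\ invertible (Bpoly_Cs w).
Proof.
exact: loc_quot_loc_frac.
Qed.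

Lemma C'_gram i : (yC' p phi d_ i)^T *m (B_C' p phi d_ aB)%:M *m yC' p phi d_ i =
  (B_C' p phi d_ bB)%:M.
Proof.
apply/eqP; rewrite -subr_eq0; apply/eqP.
transitivity (map_mx (@quot_pi _ (@Crel F M p phi d_))
    ((yloc p d_ i)^T *m Amx p phi d_ i *m yloc p d_ i - Bmx p d_ i)).
  by rewrite map_mxB !map_mxM map_trmx !map_scalar_mx aBE bBE.
apply/matrixP => j k; rewrite [LHS]mxE [RHS]mxE; apply: quot_pi_gen.
by exists i, j, k; left.
Qed.

Lemma C'_torsion k : B_C' p phi d_ aB * (yC' p phi d_ 0 - 1%:M) k 1 =
  B_C' p phi d_ aB * (yC' p phi d_ 1 - 1%:M) k 0.
Proof.
have tr i j : B_C' p phi d_ aB * (yC' p phi d_ i - 1%:M) k j =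
    quot_pi _ ((Amx p phi d_ i *m (yloc p d_ i - 1%:M)) k j).
  transitivity (map_mx (@quot_pi _ (@Crel F M p phi d_))
      (Amx p phi d_ i *m (yloc p d_ i - 1%:M)) k j); last by rewrite mxE.
  by rewrite map_mxM map_mxB !map_scalar_mx rmorph1 aBE mul_scalar_mx [RHS]mxE.
apply/eqP; rewrite !tr -subr_eq0 -rmorphB; apply/eqP; apply: quot_pi_gen.
by exists 0, 1, k; right.
Qed.

Lemma C'_b_invertible : invertible (B_C' p phi d_ bB).
Proof.
have : invertible (Bpoly_C' ((b_ p d_ 0 * b_ p d_ 1)%:MP * DX F M)).
  apply: (invertible_rmorph (@quot_pi _ (@Crel F M p phi d_))).
  exact: loc_map_invertible.
rewrite rmorphM => /invertible_mull; rewrite !bBE mpolyCM rmorphM.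
exact: invertible_mull.
Qed.

(** A diagonal entry of the orthogonality relation exhibits the unit [b] as a multiple of [a]. *)
Lemma C'_a_invertible : invertible (B_C' p phi d_ aB).
Proof.
have := congr1 (fun X : 'M[C']_2 => X 0 0) (C'_gram 0).
rewrite mul_mx_scalar -scalemxAl [LHS]mxE [RHS]mxE mulr1n => e.
by move: C'_b_invertible; rewrite -e; apply: invertible_mull.
Qed.

(** Since [a] is invertible, [pzinv] returns a genuine inverse and not its default 0. *)
Lemma C'_theta i : B_C' p phi d_ aB * theta_ p phi d_ i = B_C' p phi d_ bB.
Proof.
by rewrite /theta_ aBE bBE mulrCA pzinv_mul ?mulr1 //; apply: C'_a_invertible.
Qed.

Hypothesis two_inv : exists t : O, 2%:R * t = 1.

Lemma Cs_two_invertible : invertible (2%:R : Cs).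
Proof.
have [t t2] := two_inv; exists (pi' p phi d_ (BF_const t)).
have := congr1 (fun x => pi' p phi d_ (BF_const x)) t2.
by rewrite !rmorphM !rmorph_nat !rmorph1.
Qed.

Definition vs : Cs := ys p phi d_ 0 0 1.

Lemma ys_cmx : ys p phi d_ 0 = cmx (1 + vs) vs /\ ys p phi d_ 1 = cmx (1 + vs) (- vs).
Proof.
pose l : {rmorphism C' -> Cs} := @loc_map _ (sC' p phi d_).
pose t := B_C' p phi d_ bB * pzinv (B_C' p phi d_ aB).
have thetaE i : theta_ p phi d_ i = t by rewrite /theta_ aBE bBE.
have ysl i : ys p phi d_ i = map_mx l (yC' p phi d_ i) by [].
apply: (canonical_pair (a := pi' p phi d_ aB) (b := pi' p phi d_ bB) (t := l t)).
- exact: Cs_two_invertible.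
- exact: (invertible_rmorph l C'_a_invertible).
- exact: (invertible_rmorph l C'_b_invertible).
- by have := congr1 l (C'_theta 0); rewrite thetaE rmorphM.
- by move=> i; exact: (map_mx_gram l (C'_gram i)).
- have e : sC' p phi d_ = \tr (yC' p phi d_ 0) * (\det (yC' p phi d_ 0) + t)
      * (\tr (yC' p phi d_ 1) * (\det (yC' p phi d_ 1) + t)).
    by rewrite /sC' prod2E (thetaE 0) (thetaE 1).
  (* Inverting [s] inverts each [det y_i + theta], which excludes determinant [- theta]. *)
  have us : invertible (l (sC' p phi d_)) by exact: loc_map_invertible.
  have [u0 u1] := invertible_rmorph_factors e us.
  move=> i; change (invertible (\det (map_mx l (yC' p phi d_ i)) + l t)).
  rewrite map_mx_det_add.
  by case: (ord2P i) => ->.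
- by move=> k; exact: (map_mx_torsion l (C'_torsion k)).
Qed.

Lemma Cs_norm : pi' p phi d_ aB * ((1 + vs) ^+ 2 + vs ^+ 2) = pi' p phi d_ bB.
Proof.
have := map_mx_gram (@loc_map _ (sC' p phi d_)) (C'_gram 0).
rewrite -[map_mx _ (yC' p phi d_ 0)]/(ys p phi d_ 0) ys_cmx.1 cmx_gram.
by move=> /(congr1 (fun X : 'M[Cs]_2 => X 0 0)); rewrite !mxE.
Qed.

Lemma pi'_a_invertible : invertible (pi' p phi d_ aB).
Proof. exact: (invertible_rmorph (@loc_map _ (sC' p phi d_)) C'_a_invertible). Qed.

Lemma pi'_b_invertible : invertible (pi' p phi d_ bB).
Proof. exact: (invertible_rmorph (@loc_map _ (sC' p phi d_)) C'_b_invertible). Qed.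

(** Reduces maps out of [C'_s] to a single parameter [v] satisfying the norm relation. Up to sign,
    [1 + 2 v] is the last factor of [D(y)], and [1 + v] is half of each trace. *)
Lemma Cs_lift (T : comPzRingType) (h : {rmorphism Bpoly F M -> T}) (v : T) :
  invertible (h bB%:MP) -> invertible (1 + v) -> invertible (1 + v *+ 2) ->
  h aB%:MP * ((1 + v) ^+ 2 + v ^+ 2) = h bB%:MP ->
  map_mx h (yX F M 0) = cmx (1 + v) v -> map_mx h (yX F M 1) = cmx (1 + v) (- v) ->
  exists k : {rmorphism Cs -> T}, k \o Bpoly_Cs =1 h.
Proof.
move=> ub uv uv2 ab_v hy0 hy1; set t := (1 + v) ^+ 2 + v ^+ 2 in ab_v.
have ua : invertible (h aB%:MP) by move: ub; rewrite -ab_v; apply: invertible_mull.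
have ut : invertible t by move: ub; rewrite -ab_v; apply: invertible_mulr.
have hyw i : exists w, map_mx h (yX F M i) = cmx (1 + v) w /\ (1 + v) ^+ 2 + w ^+ 2 = t.
  by case: (ord2P i) => ->; [exists v | exists (- v); rewrite sqrrN].
have detw w : \det (cmx (1 + v) w) = (1 + v) ^+ 2 + w ^+ 2.
  by rewrite det2E !cmxE; ring.
have hdet i : h (\det (yX F M i)) = t.
  by have [w [ew et]] := hyw i; rewrite -det_map_mx ew detw.
have hyE i j k : h (yX F M i j k) = map_mx h (yX F M i) j k by rewrite [RHS]mxE.
have t2 : exists c : T, 2%:R * c = 1.
  have [c c2] := two_inv; exists (h (BF_const c)%:MP).
  have := congr1 (fun x => h (BF_const x)%:MP) c2.
  by rewrite !rmorphM !rmorph_nat !rmorph1.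
apply: loc_quot_loc_lift => [|h1 e1 x [i [j [k [->|->]]]]|h2 e2].
- have hD : h (DX F M) = t * t * - (1 + v *+ 2).
    apply: etrans (rmorph_det2_mul h (yX F M 0) (yX F M 1)) _.
    by rewrite hy0 hy1 !detw sqrrN !cmxE; congr (_ * _); ring.
  rewrite !bBE (rmorphM h) hD mpolyCM (rmorphM h).
  apply: invertibleM; first exact: invertibleM.
  apply: invertibleM; first exact: invertibleM.
  by have [c ec] := uv2; exists (- c); rewrite mulrNN.
- have ylE : map_mx h1 (yloc p d_ i) = map_mx h (yX F M i).
    by apply/matrixP => i' j'; rewrite !mxE -e1.
  have [w [ew et]] := hyw i.
  have := congr1 (fun X : 'M[T]_2 => X j k)
    (map_mx_gram_sub h1 (yloc p d_ i) (B_Cloc p d_ aB) (B_Cloc p d_ bB)).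
  rewrite -{1}(aBE i) -{1}(bBE i) mxE => ->.
  rewrite ylE ew cmx_gram et -[h1 (B_Cloc p d_ aB)]/((h1 \o _) aB%:MP).
  by rewrite -[h1 (B_Cloc p d_ bB)]/((h1 \o _) bB%:MP) !e1 ab_v subrr mxE.
- have ylE i' : map_mx h1 (yloc p d_ i') = map_mx h (yX F M i').
    by apply/matrixP => j' k'; rewrite !mxE -e1.
  have AE i' j' k' : h1 ((Amx p phi d_ i' *m (yloc p d_ i' - 1%:M)) j' k') =
      h aB%:MP * (map_mx h (yX F M i') - 1%:M) j' k'.
    by rewrite rmorph_scalar_mul ylE aBE -[h1 _]/((h1 \o _) aB%:MP) e1.
  have sub1 w : cmx (1 + v) w - 1%:M = cmx v w.
    apply: matrix2P; rewrite [LHS]mxE [X in _ + X = _]mxE scalar2E !cmxE; by ring.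
  rewrite (rmorphB h1) !AE -mulrBr; apply/eqP; rewrite (_ : _ - _ = 0) ?mulr0 //.
  case: (ord2P i) (ord2P j) (ord2P k) => -> [] -> [] ->; rewrite ?subrr //;
    by rewrite ?hy0 ?hy1 !sub1 !cmxE; ring.
have thE i : h2 (theta_ p phi d_ i) = t.
  apply: (invertible_mulI ua); rewrite ab_v -[h aB%:MP]e2 -[h bB%:MP]e2.
  by have := congr1 h2 (C'_theta i); rewrite (rmorphM h2).
have yE i : map_mx h2 (yC' p phi d_ i) = map_mx h (yX F M i).
  by apply/matrixP => j k; rewrite !mxE -e2.
have factor i :
    invertible (h2 (\tr (yC' p phi d_ i) * (\det (yC' p phi d_ i) + theta_ p phi d_ i))).
  rewrite rmorph_tr_det thE yE; have [w [-> ew]] := hyw i.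
  rewrite detw ew /mxtrace sum2E !cmxE -!mulr2n.
  (* The trace is [2 (1 + v)] and [det y_i + theta] becomes [2 t]. *)
  rewrite -(mulr_natl (1 + v)) -(mulr_natl t).
  by do 2!apply: invertibleM => //.
by rewrite /sC' prod2E (rmorphM h2); apply: invertibleM; apply: factor.
Qed.

End CanonicalRing.

(** * The quadratic extension and the section modulo [P] *)

Lemma norm_mul (T : comPzRingType) (a b u v : T) :
  (a * u - b * v) ^+ 2 + (a * v + b * u) ^+ 2 = (a ^+ 2 + b ^+ 2) * (u ^+ 2 + v ^+ 2).
Proof. by ring. Qed.

Lemma cmx_mul (T : comPzRingType) (a b u v : T) :
  cmx a b *m cmx u v = cmx (a * u - b * v) (a * v + b * u).
Proof. by apply: matrix2P; rewrite mulmx2E !cmxE; ring. Qed.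

Lemma map_cmx (R S : comPzRingType) (g : {rmorphism R -> S}) u v :
  map_mx g (cmx u v) = cmx (g u) (g v).
Proof. by apply: matrix2P; rewrite !mxE ?rmorphN. Qed.

(* [2 z^2 + 2 z + 1 - t] has discriminant [4 (2 t - 1)]. *)
Lemma quadratic_extension (K : fieldType) (t : K) : 2%:R != 0 :> K ->
  (forall w : K, w ^+ 2 <> t *+ 2 - 1) ->
  exists (L : fieldType) (f : {rmorphism K -> L}) (z : L),
    [/\ root (map_poly f (2 *: 'X^2 + 2 *: 'X + 1 - t%:P)) z,
        (1 + z) ^+ 2 + z ^+ 2 = f t,
        forall l, exists x y, l = f x + f y * z &
        forall x y, f x + f y * z = 0 -> x = 0 /\ y = 0].
Proof.
move=> two0 nsq; set q := 2 *: 'X^2 + 2 *: 'X + 1 - t%:P.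
have sz_q : size q = 3.
  have -> : q = 2 *: 'X^2 + (2 *: 'X + (1 - t)%:P) by rewrite /q polyCB polyC1 -!addrA.
  have sz1 : (size (2 *: 'X + (1 - t)%:P : {poly K})%R <= 2)%N.
    rewrite (leq_trans (size_polyD _ _)) // geq_max (leq_trans (size_scale_leq _ _)) ?size_polyX //=.
    by rewrite (leq_trans (size_polyC_leq1 _)).
  by rewrite size_polyDl size_scale ?size_polyXn.
have qE x : q.[x] *+ 2 = (x *+ 2 + 1) ^+ 2 - (t *+ 2 - 1).
  by rewrite /q !hornerD hornerN !hornerZ hornerXn hornerX !hornerC; ring.
have no_root x : ~~ root q x.
  by apply/negP => /rootP qx; apply: (nsq (x *+ 2 + 1)); apply/eqP; rewrite -subr_eq0 -qE qx mul0rn.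
have irr_q : irreducible_poly q by apply: cubic_irreducible => //; rewrite sz_q.
have [L _ [z qz genz]] := irredp_FAdjoin irr_q.
exists L, (in_alg L), z; split=> // [|l|x y e].
  move/rootP: qz; rewrite /q rmorphB !rmorphD rmorph1 /= !map_polyZ map_polyXn map_polyX.
  rewrite map_polyC rmorph_nat !hornerD hornerN !hornerZ hornerXn hornerX !hornerC.
  by move/eqP; rewrite subr_eq0 => /eqP e; apply: etrans e; ring.
  have : l \in <<1; z>>%VS by rewrite genz memvf.
  case/Fadjoin_polyP => r /polyOver1P[s ->] ->.
  (* Reduction modulo the quadratic [q] leaves a polynomial of degree at most 1. *)
  exists (modp s q)`_0, (modp s q)`_1.
  have q0 : q != 0 by rewrite -size_poly_eq0 sz_q.
  have sz_r : (size (modp s q) <= 2)%N by rewrite -ltnS -[X in (_ < X)%N]sz_q ltn_modp.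
  rewrite [in LHS](divp_eq s q) rmorphD rmorphM hornerD hornerM (rootP qz) mulr0 add0r.
  rewrite (horner_coef_wide _ (n := 2)); last by rewrite size_map_poly.
  by rewrite big_ord_recl big_ord1 !coef_map /= expr0 mulr1 expr1.
have [y0|y0] := eqVneq y 0.
  by move: e; rewrite y0 rmorph0 mul0r addr0 => /eqP; rewrite fmorph_eq0 => /eqP ->.
(* A dependence with [y] nonzero would put the root [z] into [K]. *)
have zE : z = in_alg L (- x / y).
  have fy0 : in_alg L y != 0 by rewrite fmorph_eq0.
  apply: (mulIf fy0); rewrite -rmorphM divfK // rmorphN mulrC.
  by apply/eqP; rewrite -addr_eq0 addrC; apply/eqP.
move: qz; rewrite zE => qz; have := no_root (- x / y).
by rewrite -(fmorph_root (in_alg L)) qz.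
Qed.

Section Canonical.
Variables (F : splittingFieldType rat) (M : int) (p : nat) (phi : gal_of {:F}).
Variables (d : OF F M) (d_ : 'I_2 -> OF F M) (P : OF F M -> Prop).
Hypothesis d_E : forall i, d_ i = d.
Hypothesis two_inv : exists t : OF F M, 2%:R * t = 1.
Hypotheses (M0 : M != 0) (prime_p : prime p) (primeP : is_prime_ideal P).
Hypotheses (Pp : P p%:R) (frob_phi : is_frobenius P p phi).
Hypothesis unit_d : exists e : OF F M, d * e = 1.
Notation O := (OF F M).
Notation B := (BF F M).
Notation Cs := (Cs p phi d_).
Notation pi' := (pi' p phi d_).
Notation ys := (ys p phi d_).
Notation vs := (vs p phi d_).
Notation aB := (aB p phi d).
Notation bB := (bB p d).

Lemma normB_invertible : invertible (alphaB ^+ 2 + betaB ^+ 2 : B).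
Proof.
have := OP_BF_norm_invertible F M.
by rewrite /OP_norm rmorphD (rmorphXn (OP_BF F M)) (rmorphXn (OP_BF F M)) OP_BF0 OP_BF1.
Qed.

Lemma bB_invertible : invertible bB.
Proof.
rewrite bB_def; apply: invertibleM; apply: invertibleX; first exact: normB_invertible.
exact: (invertible_rmorph (@BF_const F M) unit_d).
Qed.

(** Thus [theta] is 1 modulo [P], which is why [y_i = 1] solves the equations there. *)
Lemma quot_aB_bB : quot_pi _ aB = quot_pi _ bB :> BmodP P.
Proof.
have p0 : p%:R = 0 :> BmodP P.
  rewrite -(rmorph_nat (quot_pi _)); apply: quot_pi_gen; exists p%:R => //.
  by rewrite rmorph_nat.
have frobD := exprDn_prime prime_p p0.
rewrite aB_def bB_def !rmorphM; congr (_ * _).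
  by rewrite (rmorphXn (quot_pi _)) !rmorphD frobD -!rmorphXn -!exprM.
rewrite -rmorphXn; apply/quot_piP; rewrite -rmorphB => I _; apply.
by exists (gal_OF phi d - d ^+ p); first exact: frob_phi.
Qed.

Lemma section_exists : exists S : {rmorphism Cs -> BmodP P}, is_section S.
Proof.
have [h0 [h0C h0Y]] := Bpoly_lift [the {rmorphism B -> B} of idfun] (fun _ => cmx 1 0).
pose h : {rmorphism Bpoly F M -> BmodP P} := quot_pi _ \o h0.
have hC c : h c%:MP = quot_pi _ c by rewrite /h /= h0C.
have hY i : map_mx h (yX F M i) = cmx 1 0.
  apply/matrixP => j k; transitivity (quot_pi (fun x : B => exists2 c : O, P c & x = BF_const c)
    (h0 (yX F M i j k))); first by rewrite [LHS]mxE.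
  have -> : h0 (yX F M i j k) = cmx 1 0 j k by rewrite -(h0Y i) [RHS]mxE.
  transitivity (map_mx (quot_pi (fun x : B => exists2 c : O, P c & x = BF_const c))
    (cmx 1 0) j k); first by rewrite [RHS]mxE.
  by rewrite map_cmx rmorph1 rmorph0.
(* The identity matrices correspond to the parameter [v = 0]. *)
have [||||||S eS] := @Cs_lift F M p phi d d_ d_E two_inv _ h 0.
- by rewrite hC; apply: (invertible_rmorph (quot_pi _)); apply: bB_invertible.
- by exists 1; rewrite addr0 mulr1.
- by exists 1; rewrite mul0rn addr0 mulr1.
- by rewrite !hC quot_aB_bB addr0 expr0n expr1n addr0 mulr1.
- by rewrite hY addr0.
- by rewrite hY addr0 oppr0.
exists S; split=> [b|i]; first by rewrite -Bpoly_CsC -[LHS]/((S \o _) _) eS hC.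
rewrite ysE scalar2E -(hY i); apply/matrixP => j k.
by rewrite [LHS]mxE [X in S X]mxE [RHS]mxE -eS.
Qed.

(** Only [alpha^2 + beta^2] must become invertible. Its image is
    [(alpha^(2p) + beta^(2p)) ((1+v)^2 + v^2)], and this times the conjugate of [d] equals the unit
    [b]. *)
Lemma phi'_exists i : exists f : {rmorphism B -> Cs}, is_phi' i f.
Proof.
pose bp (c : B) : Bpoly F M := c%:MP.
(* The first row of the matrix product that prescribes the images of [alpha] and [beta]. *)
pose y (j : 'I_2) : Bpoly F M := if j == ord0
  then bp (alphaB ^+ p) * yX F M i 0 0 + bp (betaB ^+ p) * yX F M i 1 0
  else bp (alphaB ^+ p) * yX F M i 0 1 + bp (betaB ^+ p) * yX F M i 1 1.
pose psi0 : {rmorphism {mpoly O[2]} -> Bpoly F M} :=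
  mmap (@mpolyC #|Yvar| B \o (@BF_const F M \o gal_OF phi)) y.
pose psi : {rmorphism {mpoly O[2]} -> Cs} := Bpoly_Cs p phi d_ \o psi0.
have psiC c : psi c%:MP = pi' (BF_const (gal_OF phi c)).
  by rewrite -Bpoly_CsC /psi /= mmapC.
have [w [ew nw]] : exists w,
    ys i = cmx (1 + vs) w /\ (1 + vs) ^+ 2 + w ^+ 2 = (1 + vs) ^+ 2 + vs ^+ 2.
  have [y0 y1] := @ys_cmx F M p phi d d_ d_E two_inv.
  by case: (ord2P i) => ->; [exists vs | exists (- vs); rewrite sqrrN].
have yE j k : Bpoly_Cs p phi d_ (yX F M i j k) = cmx (1 + vs) w j k.
  by rewrite -ew ysE [RHS]mxE.
pose A := pi' (alphaB ^+ p); pose E := pi' (betaB ^+ p).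
have psi0E : psi 'X_ord0 = A * (1 + vs) - E * w.
  have -> : psi 'X_ord0 = Bpoly_Cs p phi d_ (y ord0) by rewrite /psi /= mmapX mmap1U.
  rewrite /y eqxx (rmorphD (Bpoly_Cs _ _ _)) !(rmorphM (Bpoly_Cs _ _ _)) !yE !cmxE.
  by rewrite mulrN.
have psi1E : psi 'X_ord_max = A * w + E * (1 + vs).
  have -> : psi 'X_ord_max = Bpoly_Cs p phi d_ (y ord_max) by rewrite /psi /= mmapX mmap1U.
  rewrite -[y ord_max]/(bp (alphaB ^+ p) * yX F M i 0 1 + bp (betaB ^+ p) * yX F M i 1 1).
  by rewrite (rmorphD (Bpoly_Cs _ _ _)) !(rmorphM (Bpoly_Cs _ _ _)) !yE !cmxE.
have [|f ef] := @BF_lift F M _ psi.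
  rewrite /OP_norm (rmorphD psi) !(rmorphXn psi) psi0E psi1E.
  rewrite norm_mul nw.
  apply: (@invertible_mull _ _ (pi' (BF_const (gal_OF phi d)))).
  have -> : (A ^+ 2 + E ^+ 2) * ((1 + vs) ^+ 2 + vs ^+ 2) * pi' (BF_const (gal_OF phi d)) =
      pi' aB * ((1 + vs) ^+ 2 + vs ^+ 2).
    rewrite mulrAC; congr (_ * _); rewrite aB_def (rmorphM pi') (rmorphD pi').
    by rewrite /A /E -!(rmorphXn pi') -!exprM (mulnC 2).
  by rewrite (@Cs_norm F M p phi d d_ d_E two_inv); exact: (@pi'_b_invertible F M p phi d d_ d_E).
have fC c : f (BF_const c) = pi' (BF_const (gal_OF phi c)).
  by rewrite -OP_BFC -psiC -ef.
have f0 : f alphaB = A * (1 + vs) - E * w by rewrite -OP_BF0 -psi0E -ef.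
have f1 : f betaB = A * w + E * (1 + vs) by rewrite -OP_BF1 -psi1E -ef.
exists f; split=> //; rewrite ew.
by rewrite !map_cmx f0 f1 cmx_mul.
Qed.

End Canonical.

(** * The embedding of [C'_s] in the quadratic extension *)

Section LinearSpan.
Variables (R S : comPzRingType) (g : {rmorphism R -> S}) (v : S) (a c0 c1 : R).
Hypothesis v2 : g a * v ^+ 2 = g c0 + g c1 * v.

(** Denominator-free form of the span of 1 and [v] after inverting [a]; the quadratic relation for
    [v] makes it closed under products. *)
Definition lin_span (x : S) : Prop :=
  exists n b0 b1, g a ^+ n * x = g b0 + g b1 * v.

Lemma lin_span_rmorph r : lin_span (g r).
Proof. by exists 0%N, r, 0; rewrite mul1r rmorph0 mul0r addr0. Qed.

Lemma lin_span1 : lin_span 1.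
Proof. by rewrite -(rmorph1 g); apply: lin_span_rmorph. Qed.

Lemma lin_span_gen : lin_span v.
Proof. by exists 0%N, 0, 1; rewrite mul1r rmorph0 rmorph1 mul1r add0r. Qed.

Lemma lin_spanD x y : lin_span x -> lin_span y -> lin_span (x + y).
Proof.
move=> [n [b0 [b1 ex]]] [m [e0 [e1 ey]]].
exists (n + m)%N, (a ^+ m * b0 + a ^+ n * e0), (a ^+ m * b1 + a ^+ n * e1).
rewrite !rmorphD !rmorphM !rmorphXn.
transitivity (g a ^+ m * (g a ^+ n * x) + g a ^+ n * (g a ^+ m * y)).
  by rewrite exprD; ring.
by rewrite ex ey; ring.
Qed.

Lemma lin_spanM x y : lin_span x -> lin_span y -> lin_span (x * y).
Proof.
move=> [n [b0 [b1 ex]]] [m [e0 [e1 ey]]].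
exists (n + m).+1, (a * (b0 * e0) + b1 * e1 * c0),
  (a * (b0 * e1 + b1 * e0) + b1 * e1 * c1).
rewrite !rmorphD !rmorphM !rmorphD !rmorphM.
transitivity (g a * ((g a ^+ n * x) * (g a ^+ m * y))).
  by rewrite exprS exprD; ring.
rewrite ex ey; transitivity (g a * (g b0 * g e0) + g a * (g b0 * g e1 + g b1 * g e0) * v
  + g b1 * g e1 * (g a * v ^+ 2)); first by ring.
by rewrite v2; ring.
Qed.

Lemma lin_span_prod (I : Type) (r : seq I) (f : I -> S) :
  (forall i, lin_span (f i)) -> lin_span (\prod_(i <- r) f i).
Proof.
by move=> lf; elim/big_rec: _ => [|i x _ lx]; [exact: lin_span1 | exact: lin_spanM].
Qed.

Lemma lin_spanX x n : lin_span x -> lin_span (x ^+ n).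
Proof.
move=> lx; elim: n => [|n IHn]; first exact: lin_span1.
by rewrite exprS; apply: lin_spanM.
Qed.

Lemma lin_span_mpoly k (A : comNzRingType) (h : {rmorphism {mpoly A[k]} -> S}) :
  (forall c, lin_span (h c%:MP)) -> (forall i, lin_span (h 'X_i)) ->
  forall q, lin_span (h q).
Proof.
move=> hC hX; elim/mpolyind => [|c m q _ _ IHq].
  by rewrite rmorph0 -(rmorph0 g); apply: lin_span_rmorph.
rewrite rmorphD; apply: lin_spanD => //.
rewrite -mul_mpolyC rmorphM; apply: lin_spanM => //.
rewrite mpolyXE_id rmorph_prod; apply: lin_span_prod => i.
by rewrite rmorphXn; apply: lin_spanX.
Qed.

End LinearSpan.

Section Embedding.
Variables (F : splittingFieldType rat) (M : int) (p : nat) (phi : gal_of {:F}).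
Variables (d : OF F M) (d_ : 'I_2 -> OF F M).
Hypothesis d_E : forall i, d_ i = d.
Hypothesis two_inv : exists t : OF F M, 2%:R * t = 1.
Notation O := (OF F M).
Notation B := (BF F M).
Notation Cs := (Cs p phi d_).
Notation pi' := (pi' p phi d_).
Notation ys := (ys p phi d_).
Notation vs := (vs p phi d_).
Notation aB := (aB p phi d).
Notation bB := (bB p d).
Notation toCs := (Bpoly_Cs p phi d_).

(** The norm relation is [2 a v^2 + 2 a v + a = b]; dividing by 2 expresses [a v^2] linearly in
    [v]. *)
Lemma half_relation (T : comPzRingType) (a b t v : T) : 2%:R * t = 1 ->
  a * ((1 + v) ^+ 2 + v ^+ 2) = b -> a * v ^+ 2 = t * (b - a) + - a * v.
Proof.
move=> t2 ab; transitivity (2%:R * t * (a * v ^+ 2)); first by rewrite t2 mul1r.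
transitivity (t * (a * ((1 + v) ^+ 2 + v ^+ 2) - a) - (2%:R * t) * a * v); first by ring.
by rewrite ab t2; ring.
Qed.

Lemma Bpoly_lin_span q : lin_span pi' vs aB (toCs q).
Proof.
have [t t2] := two_inv.
have v2 : pi' aB * vs ^+ 2 = pi' (BF_const t * (bB - aB)) + pi' (- aB) * vs.
  rewrite (rmorphM pi') (rmorphB pi') (rmorphN pi').
  apply: half_relation; last exact: Cs_norm.
  by rewrite -(rmorph_nat pi') -(rmorph_nat (@BF_const F M)) -(rmorphM pi') -rmorphM t2 !rmorph1.
apply: (lin_span_mpoly v2) => [c|n]; first exact: lin_span_rmorph.
have [[[i j] k] ->] : exists x : Yvar, n = enum_rank x by exists (enum_val n); rewrite enum_valK.
have -> : toCs 'X_(enum_rank ((i, j, k) : Yvar)) = ys i j k 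
    by rewrite ysE [RHS]mxE; congr (toCs _); rewrite [RHS]mxE.
have l1v : lin_span pi' vs aB (1 + vs).
  by apply: lin_spanD; [rewrite -(rmorph1 pi'); apply: lin_span_rmorph | apply: lin_span_gen].
have lN x : lin_span pi' vs aB x -> lin_span pi' vs aB (- x).
  move=> lx; rewrite -mulN1r; apply: (lin_spanM v2) => //.
  by rewrite -(rmorphN1 pi'); apply: lin_span_rmorph.
have lv := lin_span_gen pi' vs aB; have lNv := lN _ lv; have lNNv := lN _ lNv.
have [y0 y1] := @ys_cmx F M p phi d d_ d_E two_inv.
case: (ord2P i) (ord2P j) (ord2P k) => -> [] -> [] ->;
  rewrite ?y0 ?y1 ?cmx00 ?cmx01 ?cmx10 ?cmx11;
  first [exact: l1v | exact: lv | exact: lNv | exact: lNNv].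
Qed.

Variables (L : fieldType) (f : {rmorphism EF F -> L}) (z : L).
Hypothesis z_indep : forall x y, f x + f y * z = 0 -> x = 0 /\ y = 0.

(** Up to units an element is [b_0 + b_1 v], and linear independence of 1 and [z] over [E'] detects
    both coefficients. *)
Lemma Cs_embedding_inj (g : {rmorphism Cs -> L}) :
  (forall b, g (pi' b) = f (BF_val b)) -> g vs = z -> forall x, g x = 0 -> x = 0.
Proof.
move=> gpi gv x gx.
have [q [w [e uw]]] := Cs_frac x.
have gq : g (toCs q) = 0 by rewrite -e rmorphM gx mul0r.
have [n [b0 [b1 eb]]] := Bpoly_lin_span q.
have : f (BF_val b0) + f (BF_val b1) * z = 0.
  by rewrite -!gpi -gv -(rmorphM g) -(rmorphD g) -eb (rmorphM g) gq mulr0.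
case/z_indep => /eqP v0 /eqP v1.
have b00 : b0 = 0 by apply: (@BF_val_inj F M); rewrite (eqP v0) rmorph0.
have b10 : b1 = 0 by apply: (@BF_val_inj F M); rewrite (eqP v1) rmorph0.
have q0 : toCs q = 0.
  apply: (invertible_mulI (invertibleX n (@pi'_a_invertible F M p phi d d_ d_E))).
  by rewrite eb b00 b10 (rmorph0 pi') mul0r addr0 mulr0.
by apply: (invertible_mulI uw); rewrite mulrC e q0 mulr0.
Qed.

Variable t : EF F.
Hypotheses (zt : (1 + z) ^+ 2 + z ^+ 2 = f t) (abt : BF_val aB * t = BF_val bB).
Hypothesis ub : invertible bB.

Lemma Cs_embedding_exists : exists g : {rmorphism Cs -> L},
  [/\ forall b, g (pi' b) = f (BF_val b), g vs = z &
      map_mx g (ys 0) = cmx (1 + z) z /\ map_mx g (ys 1) = cmx (1 + z) (- z)].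
Proof.
have [h [hC hY]] := @Bpoly_lift F M L (f \o BF_val)
  (fun i => if i == 0 then cmx (1 + z) z else cmx (1 + z) (- z)).
(* Gives the invertibility of [1 + z] and [1 + 2 z], whose constant coefficient is 1. *)
have indep x y : ~ (x = 0 /\ y = 0) -> invertible (f x + f y * z).
  by move=> xy; apply: invertible_neq0; apply/eqP => /z_indep.
have [||||||g eg] := @Cs_lift F M p phi d d_ d_E two_inv L h z.
- by rewrite hC; apply: (invertible_rmorph (f \o BF_val) ub).
- have -> : 1 + z = f 1 + f 1 * z by rewrite rmorph1 mul1r.
  by apply: indep => -[/eqP]; rewrite oner_eq0.
- have -> : 1 + z *+ 2 = f 1 + f 2%:R * z by rewrite rmorph1 rmorph_nat mulr_natl.
  by apply: indep => -[/eqP]; rewrite oner_eq0.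
- by rewrite !hC /= zt -(rmorphM f) abt.
- exact: hY.
- exact: hY.
have gys i : map_mx g (ys i) = map_mx h (yX F M i).
  by apply/matrixP => j k; rewrite ysE [LHS]mxE [RHS]mxE -eg; congr (g _); rewrite [LHS]mxE.
exists g; split.
- by move=> b; rewrite -[RHS]hC -eg.
- by have := congr1 (fun X : 'M[L]_2 => X 0 1) (etrans (gys 0) (hY 0)); rewrite mxE cmx01.
- by rewrite !gys !hY.
Qed.

End Embedding.

(** * Pull-back to the generic point *)

Lemma rmorph_inj_eq0 (R S : pzRingType) (f : {rmorphism R -> S}) :
  injective f -> forall x, f x = 0 -> x = 0.
Proof. by move=> inj_f x fx; apply: inj_f; rewrite fx rmorph0. Qed.

Lemma rmorphM_neq0 (R : pzRingType) (K : idomainType) (f : {rmorphism R -> K}) x y :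
  f x != 0 -> f y != 0 -> f (x * y) != 0.
Proof. by rewrite rmorphM; exact: mulf_neq0. Qed.

Lemma pushout_sym (A R1 R2 D : comPzRingType)
    (f1 : {rmorphism A -> R1}) (f2 : {rmorphism A -> R2})
    (g1 : {rmorphism R1 -> D}) (g2 : {rmorphism R2 -> D}) :
  is_pushout f1 f2 g1 g2 -> is_pushout f2 f1 g2 g1.
Proof.
move=> [e univ]; split=> [x|T h2 h1 h21]; first exact: esym (e x).
have [|k [k1 k2 kU]] := univ T h1 h2; first by move=> x; exact: esym (h21 x).
by exists k; split=> // k' k'2 k'1; apply: kU.
Qed.

Lemma subring_lift (K : comNzRingType) (A : comPzRingType) (S : K -> Prop)
    (f : {rmorphism A -> K}) : (forall x, S (f x)) ->
  exists g : {rmorphism A -> subring_type S}, forall x, val (g x) = f x.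
Proof.
move=> Sf; pose g x := Subring (mem_subring_gen (Sf x)).
have gB : zmod_morphism g by move=> x y; apply: val_inj; rewrite /= rmorphB.
have gM : monoid_morphism g.
  by split=> [|x y]; apply: val_inj; rewrite /= ?rmorph1 ?rmorphM.
pose G : {rmorphism A -> subring_type S} := HB.pack g
  (GRing.isZmodMorphism.Build A (subring_type S) g gB)
  (GRing.isMonoidMorphism.Build A (subring_type S) g gM).
by exists G.
Qed.

(* [W1] is [L] itself and [W2] is the subring of [L] consisting of the
   [c s / r (u b)]. *)
Lemma pullback_fraction (A R : comPzRingType) (K L : fieldType)
    (u : {rmorphism A -> K}) (pi phi : {rmorphism A -> R})
    (l r : {rmorphism K -> L}) (c : {rmorphism R -> L}) :
  (forall x, exists a b, u b != 0 /\ x * u b = u a) ->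
  (forall s, c s = 0 -> s = 0) -> l \o u =1 c \o pi -> r \o u =1 c \o phi ->
  (forall y, exists s b, u b != 0 /\ y * l (u b) = c s) ->
  is_pullback u pi phi l r c.
Proof.
move=> fracK inj_c lu ru fracL.
pose S (y : L) := exists s b, u b != 0 /\ y * r (u b) = c s.
have Sclosed : subring_closed (fun y : L => `[< S y >]).
  split=> [|x y /asboolP[s [b [ub e]]] /asboolP[s' [b' [ub' e']]]
           |x y /asboolP[s [b [ub e]]] /asboolP[s' [b' [ub' e']]]].
  - by apply/asboolP; exists 1, 1; rewrite !rmorph1 oner_eq0 mulr1.
  - apply/asboolP; exists (s * phi b' - s' * phi b), (b * b').
    rewrite rmorphM mulf_neq0 //; split=> //; rewrite rmorphB !rmorphM -e -e'.
    by rewrite -[c (phi b)]ru -[c (phi b')]ru /=; ring.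
  - apply/asboolP; exists (s * s'), (b * b').
    by rewrite rmorphM mulf_neq0 //; split=> //; rewrite !rmorphM -e -e'; ring.
have [j2 j2E] : exists g : {rmorphism R -> subring_type S}, forall x, val (g x) = c x.
  apply: subring_lift => s.
  by exists s, 1; rewrite !rmorph1 oner_eq0 mulr1.
have [i2 i2E] : exists g : {rmorphism K -> subring_type S}, forall x, val (g x) = r x.
  apply: subring_lift => x; have [a [b [ub e]]] := fracK x.
  by exists (phi a), b; rewrite -rmorphM e [LHS]ru.
have SP (w : subring_type S) : S (val w).
  by have /subring_genP/(_ _ Sclosed) := subring_valP w => /(_ _)/asboolP; apply=> y /asboolP.
pose k2 : {rmorphism subring_type S -> L} := [the {rmorphism subring_type S -> L} of val].
have valI : injective k2 by exact: val_inj.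
have j2i2 : i2 \o u =1 j2 \o phi.
  by move=> a; apply: valI; rewrite [LHS]i2E [RHS]j2E [LHS]ru.
exists L, (subring_type S), l, c, i2, j2, [the {rmorphism L -> L} of idfun], k2; split.
- exact: frac_pushout.
- apply: pushout_sym; apply: frac_pushout => // [s|w].
    by move=> /(congr1 k2); rewrite [LHS]j2E rmorph0 => /inj_c.
  have [s [b [ub e]]] := SP w; exists s, b; split=> //.
  by apply: valI; rewrite rmorphM [k2 (i2 _)]i2E [RHS]j2E -e.
(* The mediating map is [h1] itself: an element of [W2] times the unit [r (u b)] comes from [R],
   where [h1] and [h2] agree. *)
- split=> [s|T h1 h2 h12]; first by rewrite /= [RHS]j2E.
  exists h1; split=> // w.
  have [s [b [ub e]]] := SP w.
  have ub2 : invertible (h2 (i2 (u b))).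
    by apply: (invertible_rmorph h2); apply: (invertible_rmorph i2); exact: (invertible_neq0 ub).
  apply: (invertible_mulI ub2); rewrite -(rmorphM h2) [i2 (u b) * w](_ : _ = j2 s); last first.
    by apply: valI; rewrite (rmorphM k2) [k2 (i2 _)]i2E [RHS]j2E -e mulrC.
  rewrite -[h2 (j2 s)]h12 /= -e [h2 (i2 (u b))](_ : _ = h1 (r (u b))).
    by rewrite rmorphM mulrC.
  by rewrite -[i2 (u b)]/((i2 \o u) b) j2i2 -[h2 _]h12 [r (u b)]ru.
- by split=> // x; rewrite [RHS]i2E.
Qed.

Lemma minimal_prime0 (R : comPzRingType) (L : fieldType) (g : {rmorphism R -> L}) :
  (forall x, g x = 0 -> x = 0) ->
  is_minimal_prime (fun x : R => x = 0).
Proof.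
move=> inj_g; split=> [|J [[J0 _ _] _ _] _ x -> //]; split.
- by split=> [//|x y -> ->|a x ->]; rewrite ?addr0 ?mulr0.
- by move=> /(congr1 g); rewrite rmorph1 rmorph0 => /eqP; rewrite oner_eq0.
move=> x y /(congr1 g); rewrite rmorphM rmorph0 => /eqP; rewrite mulf_eq0.
by case/orP => /eqP /inj_g; [left | right].
Qed.

Lemma minimal_prime_eq0 (R : comPzRingType) (Q : R -> Prop) :
  is_minimal_prime (fun x : R => x = 0) -> is_minimal_prime Q ->
  forall x, Q x -> x = 0.
Proof.
move=> [p0 _] [[[Q0 _ _] _ _] minQ] x Qx.
by apply: (minQ (fun x : R => x = 0) p0) => // y ->.
Qed.

Lemma generates_lin (K L : fieldType) (f : {rmorphism K -> L}) (z : L) :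
  (forall l, exists x y, l = f x + f y * z) -> generates f z.
Proof.
move=> span A [A1 AB AD] fA zA l; have [x [y ->]] := span l.
have A0 : 0 \in A by rewrite -(subrr 1); apply: AB.
have AN t : t \in A -> - t \in A by move=> At; rewrite -(sub0r t); apply: AB.
rewrite -[f y * z]opprK; apply: AB => //; apply: AN.
(* [divring_closed] provides differences and quotients only, so the product is written as division
   by [z^-1]. *)
by rewrite -[z]invrK -[z^-1]mul1r; apply: (AD) => //; apply: (AD).
Qed.

(** * The non-square [2 theta - 1] and the injectivity of [phi'_i] *)

Section Final.
Variables (F : splittingFieldType rat) (M : int) (p : nat) (phi : gal_of {:F}).
Variables (d : OF F M) (d_ : 'I_2 -> OF F M) (P : OF F M -> Prop).
Hypothesis d_E : forall i, d_ i = d.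
Hypothesis two_inv : exists t : OF F M, 2%:R * t = 1.
Hypotheses (M0 : M != 0) (prime_p : prime p) (primeP : is_prime_ideal P).
Hypotheses (Pp : P p%:R) (frob_phi : is_frobenius P p phi).
Hypothesis unit_d : exists e : OF F M, d * e = 1.
Notation O := (OF F M).
Notation B := (BF F M).
Notation Cs := (Cs p phi d_).
Notation pi' := (pi' p phi d_).
Notation ys := (ys p phi d_).
Notation vs := (vs p phi d_).
Notation aB := (aB p phi d).
Notation bB := (bB p d).
Notation theta := (theta_p p phi (OF_val d)).

Lemma BF_val_aB : BF_val aB =
  EF_const (phi (OF_val d)) * (alpha ^+ (2 * p) + beta ^+ (2 * p)).
Proof.
rewrite aB_def mulrC (rmorphM BF_val) (rmorphD BF_val).
by rewrite !(rmorphXn BF_val).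
Qed.

Lemma BF_val_bB : BF_val bB = EF_const (OF_val d) ^+ p * (alpha ^+ 2 + beta ^+ 2) ^+ p.
Proof.
rewrite bB_def mulrC (rmorphM BF_val) !(rmorphXn BF_val) (rmorphD BF_val).
by rewrite !(rmorphXn BF_val).
Qed.

Lemma BmodP_neq0 : (1 : BmodP P) <> 0.
Proof.
rewrite -(rmorph1 (quot_pi _)) -(rmorph1 (OP_BF F M)); apply: quot_OP_neq0 => //.
by exists 0%MM; rewrite mcoeff1 eqxx; apply: prime_ideal1.
Qed.

(** Modulo [P] the element [a] equals the unit [b], and [B' / P B'] is not the zero ring. *)
Lemma BF_val_aB_neq0 : BF_val aB != 0.
Proof.
apply/eqP => /(rmorph_inj_eq0 (@BF_val_inj F M)) a0.
have [c ec] := invertible_rmorph (quot_pi (fun x : B => exists2 c : O, P c & x = BF_const c))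
  (bB_invertible p unit_d).
have b0 : quot_pi _ bB = 0 :> BmodP P.
  by rewrite -(quot_aB_bB d prime_p Pp frob_phi) a0 rmorph0.
by apply: BmodP_neq0; rewrite -ec; exact: etrans (congr1 (fun y => y * c) b0) (mul0r c).
Qed.

Lemma aB_theta : BF_val aB * theta = BF_val bB.
Proof.
have := BF_val_aB_neq0; rewrite BF_val_bB BF_val_aB /theta_p => a0.
by rewrite mulrC divfK.
Qed.

Lemma OF_d_neq0 : OF_val d != 0.
Proof.
have [e de] := unit_d; apply/eqP => d0; have := congr1 OF_val de.
by rewrite rmorphM d0 mul0r rmorph1 => /eqP; rewrite eq_sym oner_eq0.
Qed.

Lemma theta_nonsquare (w : EF F) : odd p -> w ^+ 2 <> theta *+ 2 - 1.
Proof.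
move=> odd_p e.
have a0 : phi (OF_val d) != 0 by rewrite fmorph_eq0 OF_d_neq0.
have b0 : 2%:R * OF_val d ^+ p != 0.
  by rewrite mulf_neq0 ?expf_neq0 ?OF_d_neq0 // natF_eq0.
(* Multiplied by the denominator of [theta], [2 theta - 1] has the required form with [a = phi d]
   and [b = 2 d^p]. *)
apply: (@nonsquare_ratio F _ _ p w odd_p (prime_gt1 prime_p) a0 b0).
rewrite -BF_val_aB e mulrBl mul1r mulrC mulrnAr aB_theta BF_val_bB.
by rewrite rmorphM rmorph_nat rmorphXn -mulrA mulr_natl.
Qed.

Section Injective.
Variables (L : fieldType) (f : {rmorphism EF F -> L}) (g : {rmorphism Cs -> L}).
Hypotheses (gpi : forall b, g (pi' b) = f (BF_val b)).
Hypothesis inj_g : forall x, g x = 0 -> x = 0.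
Variables (S : {rmorphism Cs -> BmodP P}) (i : 'I_2) (fi : {rmorphism B -> Cs}).
Hypotheses (secS : is_section S) (phi_fi : is_phi' i fi).

(** The section sends [y_i] to 1, so it turns [phi'_i] into the Frobenius modulo [P]. *)
Lemma section_phi' (h : {mpoly O[2]}) : S (fi (OP_BF F M h)) = quot_pi _ (OP_BF F M h ^+ p).
Proof.
have [Spi Sys] := secS; have [fiC fiM] := phi_fi.
pose k : {rmorphism {mpoly O[2]} -> BmodP P} := S \o (fi \o OP_BF F M).
have kE : forall j, k 'X_j = quot_pi _ (OP_BF F M 'X_j) ^+ p.
  have := congr1 (map_mx S) fiM; rewrite (map_mxM S) Sys mulmx1 !map_cmx !Spi => e j.
  rewrite /k /= -rmorphXn; have [->|->] := ord2_cases j.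
    rewrite OP_BF0; have := congr1 (fun X : 'M[BmodP P]_2 => X 0 0) e.
    by rewrite !cmx00.
  rewrite OP_BF1; have := congr1 (fun X : 'M[BmodP P]_2 => X 0 1) e.
  by rewrite !cmx01.
have kC c : k c%:MP = quot_pi _ (BF_const (gal_OF phi c)).
  by rewrite /k /= OP_BFC fiC Spi.
exact: (BmodP_frobenius prime_p Pp frob_phi kC kE).
Qed.

(** A nonzero polynomial [h] in the kernel is rescaled to a primitive [h'] with [c h' = a h] and [c]
    nonzero. As [C'_s] embeds in a field, [h'] is in the kernel too, so [h'^p] vanishes modulo [P],
    against Gauss's lemma. *)
Lemma phi'_inj b : fi b = 0 -> b = 0.
Proof.
move=> fb0; have [h [n eh]] := BF_frac b.
have fh0 : fi (OP_BF F M h) = 0 by rewrite -eh rmorphM fb0 mul0r.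
have [h0|h0] := eqVneq h 0.
  have uN := invertibleX n (OP_BF_norm_invertible F M).
  apply: (invertible_mulI uN); rewrite -rmorphXn mulrC eh h0 rmorph0.
  by rewrite mulr0.
have hF : map_mpoly OF_val h != 0.
  apply: contra_neq h0 => hF; apply: (rmorph_inj_eq0 (@OP_EF_inj F M)).
  by rewrite /OP_EF /= hF rmorph0.
have [x [h' [eh' Ph']]] := scale_OP M0 prime_p primeP Pp hF.
have [a [c [eac nac]]] := OF_fraction M0 prime_p primeP Pp x.
have c0 : OF_val c != 0.
  rewrite OF_val_eq0; apply/eqP => c0; apply: nac; rewrite c0.
  suff -> : a = 0 by split; apply: prime_ideal0.
  by apply: OF_val_inj; rewrite -eac c0 rmorph0 mul0r.
have ech : c%:MP * h' = a%:MP * h.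
  apply: (@OP_EF_inj F M); rewrite !(rmorphM (OP_EF F M)) !OP_EFC eh' -eac rmorphM.
  by rewrite mulrA.
have : g (fi (BF_const c)) * g (fi (OP_BF F M h')) = 0.
  by rewrite -!rmorphM -OP_BFC -rmorphM ech !rmorphM fh0 rmorph0 mulr0.
move/eqP; rewrite phi_fi.1 gpi mulf_eq0 fmorph_eq0 => /orP[|/eqP/inj_g fh'].
  by rewrite -[BF_val _]/(EF_const (phi (OF_val c))) !fmorph_eq0 (negbTE c0).
have := section_phi' h'; rewrite fh' rmorph0 -rmorphXn => /esym.
case/quot_OP_neq0 => //; exact: mpoly_prime_ideal_exp.
Qed.

End Injective.
End Final.

Lemma OF_two_invertible (F : splittingFieldType rat) (M : int) : M != 0 -> (2 %| M)%Z ->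
  exists t : OF F M, 2%:R * t = 1.
Proof.
move=> M0 /dvdzP[k Mk].
have inM : (M%:~R^-1 : F) \in subring_gen (fun x : F => is_integral x \/ x = M%:~R^-1).
  by apply: mem_subring_gen; right.
exists (k%:~R * Subring inM); apply: (@OF_val_inj F M).
rewrite !rmorphM rmorph_nat rmorph_int rmorph1 /= mulrA.
have -> : 2%:R * k%:~R = M%:~R :> F by rewrite Mk intrM mulrC.
by rewrite mulfV // intF_eq0.
Qed.

Lemma gauge_twist_fixed (F : splittingFieldType rat) (M : int)
    (sigma : 'I_2 -> gal_of {:F}) (d : OF F M) i :
  gal_OF (sigma i) d = d -> gauge_twist sigma d i = d.
Proof.
move=> e; rewrite /gauge_twist -[in LHS]e; apply: (@OF_val_inj F M).
by rewrite /= -galM ?memvf // mulgV gal_id.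
Qed.

(** * Canonical data and their pull-back to [E'] *)

Section Pullback.
Variables (F : splittingFieldType rat) (M : int) (p : nat) (phi : gal_of {:F}).
Variables (d : OF F M) (d_ : 'I_2 -> OF F M) (P : OF F M -> Prop).
Hypothesis d_E : forall i, d_ i = d.
Hypotheses (M0 : M != 0) (evenM : (2 %| M)%Z) (odd_p : odd p).
Hypotheses (prime_p : prime p) (primeP : is_prime_ideal P).
Hypotheses (Pp : P p%:R) (frob_phi : is_frobenius P p phi).
Hypothesis unit_d : exists e : OF F M, d * e = 1.
Notation Cs := (Cs p phi d_).
Notation pi' := (pi' p phi d_).
Notation ys := (ys p phi d_).
Notation vs := (vs p phi d_).
Notation theta := (theta_p p phi (OF_val d)).

Lemma embedding_exists :
  exists (L : fieldType) (f : {rmorphism EF F -> L}) (z : L) (g : {rmorphism Cs -> L}),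
    [/\ root (map_poly f (2 *: 'X^2 + 2 *: 'X + 1 - theta%:P)) z,
        forall l, exists x y, l = f x + f y * z,
        (forall b, g (pi' b) = f (BF_val b)) /\ g vs = z,
        map_mx g (ys 0) = cmx (1 + z) z /\ map_mx g (ys 1) = cmx (1 + z) (- z) &
        forall x, g x = 0 -> x = 0].
Proof.
have two_inv := OF_two_invertible F M0 evenM.
have two0 : 2%:R != 0 :> EF F.
  by rewrite -(rmorph_nat EF_const) fmorph_eq0 natF_eq0.
have nsq w := theta_nonsquare prime_p primeP Pp frob_phi unit_d (w := w) odd_p.
have [L [f [z [qz zt span indep]]]] := quadratic_extension two0 nsq.
have [g [gpi gv gy]] := Cs_embedding_exists d_E two_inv indep zt
  (aB_theta prime_p primeP Pp frob_phi unit_d) (bB_invertible p unit_d).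
exists L, f, z, g; split=> //.
exact: (Cs_embedding_inj d_E two_inv indep gpi gv).
Qed.

Lemma canonical_data_exists : exists S Q phi', @is_canonical_data F M p phi d_ P S Q phi'.
Proof.
have two_inv := OF_two_invertible F M0 evenM.
have [L [f [z [g [_ _ _ _ inj_g]]]]] := embedding_exists.
have [S secS] := section_exists d_E two_inv prime_p Pp frob_phi unit_d.
have /choice[phi' phi'P] := @phi'_exists F M p phi d d_ d_E two_inv.
(* [C'_s] is a domain, so its only component is the whole spectrum. *)
exists S, (fun x => x = 0), phi'; split=> //; split; first exact: minimal_prime0 inj_g.
by move=> q [[q0 _ _] _ _] x ->; rewrite rmorph0.
Qed.

Lemma canonical_data_pullback S Q phi' : @is_canonical_data F M p phi d_ P S Q phi' ->
  exists (L : fieldType) (c : {rmorphism quot Q -> L})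
    (piL : {rmorphism EF F -> L}) (phiL : 'I_2 -> {rmorphism EF F -> L}),
    (forall i, is_pullback BF_val (restrict Q pi') (restrict Q (phi' i))
                 piL (phiL i) c) /\
    exists v : L,
      let u := 1 + v in
      [/\ root (map_poly piL (2 *: 'X^2 + 2 *: 'X + 1 - theta%:P)) v,
          generates piL v,
          forall i (x : F), phiL i (EF_const x) = piL (EF_const (phi x)),
          map_mx (phiL 0) (cmx alpha beta) =
            map_mx piL (cmx (alpha ^+ p) (beta ^+ p)) *m cmx u v &
          map_mx (phiL 1) (cmx alpha beta) =
            map_mx piL (cmx (alpha ^+ p) (beta ^+ p)) *m cmx u (- v)].
Proof.
case=> secS [minQ _] phi'P.
have [L [f [z [g [qz span [gpi gv] [gy0 gy1] inj_g]]]]] := embedding_exists.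
have fracB := EF_frac M0 prime_p primeP Pp.
(* Every admissible [Q] is zero, so [g] factors through the quotient by [Q]. *)
have Q0 := minimal_prime_eq0 (minimal_prime0 inj_g) minQ.
have [c cE] : exists c : {rmorphism quot Q -> L}, c \o quot_pi Q =1 g.
  by apply: quot_lift => x /Q0 ->; rewrite rmorph0.
have inj_c s : c s = 0 -> s = 0.
  have [x ->] := quot_pi_surj s; rewrite -[c _]/((c \o quot_pi Q) x) cE => /inj_g ->.
  exact: rmorph0.
have inj_phi i b : phi' i b = 0 -> b = 0.
  exact: (phi'_inj M0 prime_p primeP Pp frob_phi gpi inj_g secS (phi'P i)).
(* Injectivity of [phi'_i] makes the images of nonzero denominators invertible in [L]. *)
have /choice[phiL phiLE] : forall i, exists k : {rmorphism EF F -> L},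
    k \o BF_val =1 g \o phi' i.
  move=> i; apply: frac_ext => [x|a a0].
    have [a [b [vb e]]] := fracB x; exists a, b; split=> //.
    apply: invertible_neq0; apply: contra_neq vb => gb.
    by rewrite (inj_phi i _ (inj_g _ gb)) rmorph0.
  by rewrite (rmorph_inj_eq0 (@BF_val_inj F M) a0) rmorph0.
have phiLC i (c0 : OF F M) : phiL i (EF_const (OF_val c0)) = f (EF_const (phi (OF_val c0))).
  by apply: etrans (phiLE i (BF_const c0)) _; rewrite /= (phi'P i).1 gpi.
exists L, c, f, phiL; split.
  move=> i; apply: pullback_fraction => // [b|b|y].
  - by rewrite -[RHS]/((c \o quot_pi Q) (pi' b)) cE gpi.
  - by rewrite -[RHS]/((c \o quot_pi Q) (phi' i b)) cE; exact: phiLE.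
  have [x1 [x2 ->]] := span y.
  have [a1 [b1 [vb1 e1]]] := fracB x1; have [a2 [b2 [vb2 e2]]] := fracB x2.
  (* Common denominator of the two coordinates of [x1 + x2 z]. *)
  exists (quot_pi Q (pi' (a1 * b2) + pi' (a2 * b1) * vs)), (b1 * b2); split.
    exact: rmorphM_neq0.
  rewrite -[RHS]/((c \o quot_pi Q) (_ + _)) cE rmorphD (rmorphM g) gv !gpi.
  rewrite !(rmorphM BF_val) -e1 -e2 !(rmorphM f).
  move: (f x1) (f x2) (f (BF_val b1)) (f (BF_val b2)) => r1 r2 s1 s2.
  ring.
exists z; split=> //; first exact: generates_lin.
(* The action is known on [O] and passes to [F] through fractions. *)
- move=> i x; have [a [b [eab nab]]] := OF_fraction M0 prime_p primeP Pp x.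
  have b0 : OF_val b != 0.
    rewrite OF_val_eq0; apply/eqP => b0; apply: nab; rewrite b0.
    suff -> : a = 0 by split; apply: prime_ideal0.
    by apply: OF_val_inj; rewrite -eab b0 rmorph0 mul0r.
  have fb0 : f (EF_const (phi (OF_val b))) != 0 by rewrite !fmorph_eq0.
  apply: (mulfI fb0); transitivity (phiL i (EF_const (OF_val b * x))).
    by rewrite rmorphM (rmorphM (phiL i)) phiLC.
  by rewrite eab phiLC -eab !rmorphM.
- have := congr1 (map_mx g) (phi'P 0).2; rewrite (map_mxM g) gy0 !map_cmx !gpi.
  rewrite -[g _]/((g \o phi' 0) alphaB) -[g (phi' 0 betaB)]/((g \o phi' 0) betaB) -!phiLE.
  by rewrite !(rmorphXn BF_val).
- have := congr1 (map_mx g) (phi'P 1).2; rewrite (map_mxM g) gy1 !map_cmx !gpi.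
  rewrite -[g _]/((g \o phi' 1) alphaB) -[g (phi' 1 betaB)]/((g \o phi' 1) betaB) -!phiLE.
  by rewrite !(rmorphXn BF_val).
Qed.

End Pullback.

Theorem proposition3p17
  (F : splittingFieldType rat) (galF : galois 1%AS {:F})
  (D M : int) (discD : is_discriminant F D)
  (evenM : (2 %| M)%Z) (discM : (D %| M)%Z)
  (p : nat) (prime_p : prime p) (pM : ~~ (p%:Z %| M)%Z)
  (P : OF F M -> Prop) (primeP : is_prime_ideal P) (Pp : P p%:R)
  (phi : gal_of {:F}) (frob_phi : is_frobenius P p phi)
  (sigma : 'I_2 -> gal_of {:F}) (sigma1 : sigma 0 = 1%g)
  (d : OF F M) (unit_d : exists e : OF F M, d * e = 1)
  (gauge_d : gal_OF (sigma 1) d = d) :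
  let d_ := gauge_twist sigma d in
  let theta := theta_p p phi (OF_val d) in
  (* the canonical correspondences attached to q = d . 1_2 are well defined *)
  (exists S Q phi', @is_canonical_data F M p phi d_ P S Q phi') /\
  forall S Q phi', @is_canonical_data F M p phi d_ P S Q phi' ->
  (* the common pull-back Y'_{p/E'} of both correspondences is Spec L *)
  exists (L : fieldType) (c : {rmorphism quot Q -> L})
    (piL : {rmorphism EF F -> L}) (phiL : 'I_2 -> {rmorphism EF F -> L}),
    (forall i, is_pullback BF_val (restrict Q (pi' p phi d_)) (restrict Q (phi' i))
                 piL (phiL i) c) /\
    exists v : L,
      let u := 1 + v in
      [/\ root (map_poly piL (2 *: 'X^2 + 2 *: 'X + 1 - theta%:P)) v,
          generates piL v,
          forall i (x : F), phiL i (EF_const x) = piL (EF_const (phi x)),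
          map_mx (phiL 0) (cmx alpha beta) =
            map_mx piL (cmx (alpha ^+ p) (beta ^+ p)) *m cmx u v &
          map_mx (phiL 1) (cmx alpha beta) =
            map_mx piL (cmx (alpha ^+ p) (beta ^+ p)) *m cmx u (- v)].
Proof.
move=> d_ theta.
(* That [p] does not divide the even [M] excludes both [M = 0] and [p = 2]. *)
have M0 : M != 0 by apply: contraNneq pM => ->; rewrite dvdz0.
have odd_p : odd p.
  by case: (even_prime prime_p) => // p2; move: pM; rewrite p2 evenM.
have d_E i : d_ i = d.
  apply: gauge_twist_fixed; case: (ord2P i) => -> //.
  by apply: (@OF_val_inj F M); rewrite /= sigma1 gal_id.
split; first exact: (canonical_data_exists d_E).
move=> S Q phi' data.
exact: (canonical_data_pullback d_E M0 evenM odd_p prime_p primeP Pp frob_phi unit_d data).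
Qed.
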